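(* Let $n\ge 1$, $\sigma>0$ (known), $\beta\in(0,1)$, $\alpha\in(0,1-\beta)$. Let $\{S_m, m\in\mathcal M_n\}$ be a finite family of linear subspaces of $\mathbb R^n$ and $(\beta_m)_{m\in\mathcal M_n}$ numbers in $(0,1)$ such that the index $n$ belongs to $\mathcal M_n$, $S_n=\mathbb R^n$, $\dim S_m<n$ for $m\ne n$, and $\sum_{m\in\mathcal M_n}\beta_m\le\beta$. Let $\hat f,\hat\rho,\rho_m,\phi_m$ be constructed from these data and from $Y$ as described in the context. Then $\mathcal B(\hat f,\hat\rho)$ is a confidence ball with probability of coverage $1-\beta$, i.e. $$\mathbb P_{f,\sigma}[f\in\mathcal B(\hat f,\hat\rho)]\ge 1-\beta\qquad\text{for all } f\in\mathbb R^n.$$ Moreover, for each $m\in\mathcal M_n$, $f\in\mathbb R^n$ and $\gamma\in(0,1)$, if $\mathbb P_{f,\sigma}[\phi_m(Y)=0]\ge 1-\gamma$, then $\mathbb P_{f,\sigma}[\hat\rho\le\rho_m]\ge 1-\gamma$. In particular, for all $m\in\mathcal M_n$, $$\inf_{f\in S_m}\mathbb P_{f,\sigma}[\hat\rho\le\rho_m]\ge 1-\alpha.$$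
   Context: $\mathbb P_{f,\sigma}$ is the law of $Y=f+\sigma\varepsilon$ with $f\in\mathbb R^n$ and $\varepsilon$ standard Gaussian in $\mathbb R^n$ (mean $0$, identity covariance). $\|\cdot\|$ is the Euclidean norm on $\mathbb R^n$; $\Pi_S$ is the orthogonal projector onto a linear subspace $S$; $\mathcal B(x,r)$ is the (closed) Euclidean ball with center $x$ and radius $r$. For $z\ge0$ and integer $d\ge1$, $\chi^2_{z,d}(\cdot)$ is the distribution function of the noncentral $\chi^2$ distribution with $d$ degrees of freedom and noncentrality parameter $z$ (the law of $\|\mu+\xi\|^2$ with $\xi$ standard Gaussian in $\mathbb R^d$ and $\|\mu\|^2=z$, of mean $z+d$), and $q_{z,d}(u)$ is its $(1-u)$-quantile: if $X$ has this law then $\mathbb P(X\ge q_{z,d}(u))=u$ for $u\in(0,1)$. Convention: $q_{0,d}(1)=-\infty$. $a\wedge b=\min(a,b)$. Construction. Put $\mathcal D_m=\dim S_m$ and $N_m=n-\mathcal D_m$. Radii $\rho_m\ge0$: for $m=n$, $\rho_n^2=q_{0,n}(\beta_n)\sigma^2$. For $m\ne n$ with $\mathcal D_m\neq0$, $$\rho_m^2=\sup_{z\ge0}\left[z+q_{0,\mathcal D_m}\left(\frac{\beta_m}{\chi^2_{z,N_m}(q_{0,N_m}(\alpha))}\wedge1\right)\right]\sigma^2 .$$ For $m\neq n$ with $\mathcal D_m=0$, $\rho_m^2=\inf\{z\ge0:\ \chi^2_{z,n}(q_{0,n}(\alpha))\le\beta_m\}\,\sigma^2$. Estimators and tests: for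 $m\ne n$, $\hat f_m=\Pi_{S_m}Y$ and $\phi_m(Y)=\mathbf 1\{\|Y-\Pi_{S_m}Y\|^2>q_{0,N_m}(\alpha)\sigma^2\}$; for $m=n$, $\hat f_n=Y$ and $\phi_n\equiv0$. Selection: $\mathcal A=\{m\in\mathcal M_n:\phi_m(Y)=0\}$ (which contains $n$), $\hat m\in\arg\min_{m\in\mathcal A}\rho_m$ (ties broken by any fixed rule), $\hat\rho=\rho_{\hat m}$, $\hat f=\hat f_{\hat m}$. *)

(* Defs.v *)
From HB Require Import structures.
From mathcomp Require Import all_boot all_order all_algebra sesquilinear.
From mathcomp Require Import all_classical all_reals all_analysis.

Set Implicit Arguments.
Unset Strict Implicit.
Unset Printing Implicit Defensive.

Import Order.TTheory GRing.Theory Num.Theory.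
Import numFieldNormedType.Exports.

Local Open Scope classical_set_scope.
Local Open Scope ring_scope.

Section euclidean.
Context {R : realType} {n : nat}.
Implicit Types u v : 'rV[R]_n.

Definition dotv u v : R := \sum_i u 0 i * v 0 i.

Let dotv_linearl v : linear_for *%R (dotv ^~ v).
Proof.
move=> a u w; rewrite /dotv mulr_sumr -big_split/=.
by apply: eq_bigr => i _; rewrite !mxE mulrDl mulrA.
Qed.

Let dotv_linearr u : linear_for (idfun \; *%R) (dotv u).
Proof.
move=> a v w; rewrite /dotv /= mulr_sumr -big_split/=.
by apply: eq_bigr => i _; rewrite !mxE mulrDr mulrCA.
Qed.

HB.instance Definition _ :=
  bilinear_isBilinear.Build R 'rV[R]_n 'rV[R]_n R *%R (idfun \; *%R)
    dotv (dotv_linearl, dotv_linearr).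

Let dotvC u v : dotv u v = (-1) ^+ false * idfun (dotv v u).
Proof. by rewrite mul1r; apply: eq_bigr => i _; rewrite mulrC. Qed.

HB.instance Definition _ :=
  isHermitianSesquilinear.Build R 'rV[R]_n false idfun dotv dotvC.

(* Not the norm `|u| of the library, which is the sup norm on matrices. *)
Definition enorm u : R := Num.sqrt (dotv u u).

Definition eball u (r : R) : set 'rV[R]_n := [set v | enorm (v - u) <= r].

Definition orthproj (S : {vspace 'rV[R]_n}) : 'rV[R]_n -> 'rV[R]_n :=
  daddv_pi S (orthov dotv S).

End euclidean.

Definition rV_display : measure_display.
Proof. exact: default_measure_display. Qed.

Section borel_rV.
Context {R : realType} {n : nat}.

Let coord (i : 'I_n) (v : 'rV[R]_n) : R := v 0 i.

(* The product (= Borel) sigma-algebra. *)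
Definition rV_measurable : set (set 'rV[R]_n) :=
  <<s \bigcup_i preimage_set_system setT (coord i) measurable >>.

Let rV_measurable0 : rV_measurable set0.
Proof. exact: sigma_algebra0. Qed.

Let rV_measurableC A : rV_measurable A -> rV_measurable (~` A).
Proof. exact: sigma_algebraC. Qed.

Let rV_measurable_bigcup (F : (set 'rV[R]_n)^nat) :
  (forall i, rV_measurable (F i)) -> rV_measurable (\bigcup_i F i).
Proof. exact: sigma_algebra_bigcup. Qed.

HB.instance Definition _ := @isMeasurable.Build rV_display 'rV[R]_n
  rV_measurable rV_measurable0 rV_measurableC rV_measurable_bigcup.

Lemma measurable_coord (i : 'I_n) :
  measurable_fun setT (fun v : 'rV[R]_n => v 0 i).
Proof.
move=> _ B mB; apply: sub_sigma_algebra; exists i => //.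
by exists B.
Qed.

Lemma measurable_fun_rV d (T : measurableType d) (g : T -> 'rV[R]_n) :
  (forall i, measurable_fun setT (fun t => g t 0 i)) -> measurable_fun setT g.
Proof.
move=> mg; apply: measurability => // _ [A [i _ [B mB <-]] <-].
by rewrite !setTI; have := mg i measurableT _ mB; rewrite setTI.
Qed.

End borel_rV.

Section std_gauss.
Context {R : realType}.

Definition cons_rV n (p : measurableTypeR R * 'rV[R]_n) : 'rV[R]_n.+1 :=
  \row_i oapp (p.2 0) p.1 (unlift ord0 i).

Lemma measurable_cons_rV n : measurable_fun setT (@cons_rV n).
Proof.
apply: measurable_fun_rV => i; under eq_fun do rewrite mxE.
case: (unliftP ord0 i) => [j|] _ /=; last exact: measurable_fst.
exact: (measurableT_comp (measurable_coord j) measurable_snd).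
Qed.

HB.instance Definition _ n :=
  isMeasurableFun.Build _ _ _ _ (@cons_rV n) (@measurable_cons_rV n).

(* The n-fold product of the law N(0,1). *)
Fixpoint std_gauss n : probability 'rV[R]_n R :=
  if n is n'.+1
  then distribution (normal_prob (0 : R) 1 \x std_gauss n')%E (@cons_rV n')
  else dirac (0 : 'rV[R]_0).

Lemma std_gauss_box n (A : 'I_n -> set R) : (forall i, measurable (A i)) ->
  std_gauss n [set v | forall i, A i (v 0 i)]
  = (\prod_i normal_prob (0 : R) 1 (A i))%E.
Proof.
elim: n A => [|n IH] A mA.
  by rewrite big_ord0 /= diracE mem_set// => -[].
rewrite big_ord_recl -IH//=.
have mB : measurable [set v : 'rV[R]_n | forall i, A (lift ord0 i) (v 0 i)].
  rewrite (_ : mkset _ =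
      \bigcap_i ((fun v : 'rV[R]_n => v 0 i) @^-1` A (lift ord0 i))).
    apply: fin_bigcap_measurable => // i _.
    by rewrite -[X in measurable X]setTI; apply: measurable_coord.
  by apply/seteqP; split => v /= h i; [move=> _|]; exact: h.
rewrite -product_measure1E//; last exact: (mA ord0).
rewrite /distribution /pushforward.
congr (_ _); apply/seteqP; split => -[x v] /=.
  move=> h; split => [|i].
    by have := h ord0; rewrite mxE unlift_none.
  by have := h (lift ord0 i); rewrite mxE liftK.
move=> [h0 h] i; rewrite mxE.
by case: (unliftP ord0 i) => [j|] ->; [exact: h|exact: h0].
Qed.

End std_gauss.

Section gaussian_shift.
Context {R : realType} {n : nat}.
Variables (f : 'rV[R]_n) (sigma : R).

Definition observation (e : 'rV[R]_n) : 'rV[R]_n := f + sigma *: e.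

Lemma measurable_observation : measurable_fun setT observation.
Proof.
apply: measurable_fun_rV => i; under eq_fun do rewrite !mxE.
apply: measurable_realfun.measurable_funD => //; apply: measurable_realfun.measurable_funM => //.
exact: measurable_coord.
Qed.

HB.instance Definition _ :=
  isMeasurableFun.Build _ _ _ _ observation measurable_observation.

Definition gauss_law : probability 'rV[R]_n R :=
  distribution (std_gauss n) observation.

End gaussian_shift.

Section noncentral_chi2.
Context {R : realType}.
Implicit Types (z x u : R) (d : nat).

(* A vector of squared norm z; by rotation invariance of the standard Gaussian
   law, chi2_cdf does not depend on which one is taken. *)
Definition chi2_mean z d : 'rV[R]_d :=
  \row_i (if val i == 0%N then Num.sqrt z else 0).

Definition chi2_cdf z d x : R :=
  fine (std_gauss d [set xi | enorm (chi2_mean z d + xi) ^+ 2 <= x]).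

(* The (1 - u)-quantile. At u = 1 the infimum is taken over the whole line,
   which gives the convention that the value there is -oo. *)
Definition chi2_quantile z d u : \bar R :=
  ereal_inf [set x%:E | x in [set x | 1 - u <= chi2_cdf z d x]].

End noncentral_chi2.

Section construction.
Context {R : realType} {n : nat} {M : finType}.
Variables (sigma alpha : R) (full : M) (S : M -> {vspace 'rV[R]_n}).
Variable beta : M -> R.
Implicit Types (m : M) (y : 'rV[R]_n).

Local Notation D m := (\dim (S m)).
Local Notation N m := (n - \dim (S m))%N.

(* Finite, hence faithfully truncated by fine: alpha is in (0,1). *)
Definition crit d : R := fine (chi2_quantile 0 d alpha).

Definition conf_radius_sq m : \bar R :=
  ((if m == full then chi2_quantile 0 n (beta m)
    else if D m != 0%N then
      ereal_sup [set z%:E + chi2_quantile 0 (D m)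
                   (Num.min (beta m / chi2_cdf z (N m) (crit (N m))) 1)%R
                | z in [set z : R | (0 <= z)%R]]
    else ereal_inf [set z%:E
                   | z in [set z : R | (0 <= z)%R /\
                                       (chi2_cdf z n (crit n) <= beta m)%R]])
   * (sigma ^+ 2)%:E)%E.

(* conf_radius_sq is finite and nonnegative in the setting where it is used. *)
Definition conf_radius m : R := Num.sqrt (fine (conf_radius_sq m)).

Definition estimator m y : 'rV[R]_n :=
  if m == full then y else orthproj (S m) y.

(* true stands for the value 1 of the test, i.e. rejection. *)
Definition gof_test m y : bool :=
  (m != full) &&
  (crit (N m) * sigma ^+ 2 < enorm (y - orthproj (S m) y) ^+ 2).

Definition accepted y : {set M} := [set m | ~~ gof_test m y].

(* The tie-breaking rule is left arbitrary; it may even depend on the data, as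
   long as the selected index is a random variable. *)
Definition is_selection (mhat : 'rV[R]_n -> M) : Prop :=
  (forall y, mhat y \in accepted y) /\
  (forall y m, m \in accepted y ->
     conf_radius (mhat y) <= conf_radius m) /\
  (forall m, measurable (mhat @^-1` [set m])).

End construction.

(* Main.v *)
(* In an orthonormal basis adapted to S_m, of which L and K collect the vectors
   in S_m and in its orthogonal complement, the test phi_m depends only on K
   and the noise, the squared loss is |fK|^2 + sigma^2 |eL|^2, and eL and eK
   are independent standard Gaussian vectors. With z = |fK|^2 / sigma^2 the
   event that m is accepted and f is at distance more than rho_m from its
   estimator has probability at most P(|eL|^2 > r) F(z), where F(z) is the
   noncentral chi-square probability of acceptance; the radius is defined so
   that either F(z) <= beta_m or r is the quantile that makes the first factor
   at most beta_m / F(z). A union bound over m gives the coverage. The Gaussian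
   input is the rotation invariance of the standard law, obtained from plane
   rotations. *)

From HB Require Import structures.
Require Import Defs.
From mathcomp Require Import all_boot all_order all_algebra sesquilinear.
From mathcomp Require Import ring lra.
From mathcomp Require Import all_classical all_reals all_analysis.
From mathcomp Require Import measurable_realfun.

Set Implicit Arguments.
Unset Strict Implicit.
Unset Printing Implicit Defensive.

Import Order.TTheory GRing.Theory Num.Theory.
Import numFieldNormedType.Exports.

Local Open Scope classical_set_scope.
Local Open Scope ring_scope.

(** The standard law is an iterated product of one-dimensional normals, so its invariance needs no
    density on the whole space: a plane rotation moves two coordinates only and is reduced, by
    Fubini, to affine substitutions on the line. Coverage uses a radius only through lower bounds on
    its square. [conf_radius] passes through [fine] and [Num.sqrt]: truncating a negative value to 0
    does no harm to such a bound, but an infinite value would also become 0, so finiteness has to be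
    proved. For the supremum this rests on two facts about the noncentral cdf: it is positive at the
    critical value and tends to 0 as the noncentrality grows. When [S m] is zero the factor P(|eL|^2
    > r) is 0 or 1 and cannot compensate for F(z). The radius is then an infimum, and the cdf must
    be antitone in the noncentrality, so that no z with F(z) > beta_m exceeds this infimum. *)

(** * Affine change of variables for Lebesgue measure on the line *)

Section affine_substitution.
Context {R : realType}.
Notation mu := (@lebesgue_measure R).

Let aff (c t : R) (x : measurableTypeR R) : measurableTypeR R := c * x + t.

Let measurable_aff c t : measurable_fun setT (aff c t).
Proof.
by apply: measurable_funD => //; apply: measurable_funM.
Qed.

(** Uniqueness of Lebesgue measure reduces the claim to half-open intervals. A negative [c] reverses
    the interval, so its closed end changes side, without effect on the length. *)
Let lebesgue_measure_aff (c t : R) (A : set (measurableTypeR R)) :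
  c != 0 -> measurable A -> mu A = (`|c|%:E * pushforward mu (aff c t) A)%E.
Proof.
move=> c0 mA.
pose nu := mscale (NngNum (normr_ge0 c)) (pushforward mu (aff c t)).
rewrite (@lebesgue_measure_unique R (nu (measurable_aff c t)))//.
move=> _ [[a b] _ <-].
rewrite lebesgue_measure_itv/= lte_fin.
rewrite [RHS](_ : _ = `|c|%:E * mu (aff c t @^-1` `]a, b]))%E//.
have [c_lt0|c_gt0] : (c < 0) \/ (0 < c) by case: ltgtP c0 => //; [left|right].
- rewrite (_ : aff c t @^-1` _ = `[(b - t) / c, (a - t) / c[%classic);
    last first.
    apply/seteqP; split => x /=; rewrite !in_itv/= ler_ndivrMr// ltr_ndivlMr//.
      by rewrite /aff => /andP[? ?]; apply/andP; split; lra.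
    by rewrite /aff => /andP[? ?]; apply/andP; split; lra.
  rewrite lebesgue_measure_itv/= lte_fin ltr_ndivlMr// divfK//.
  rewrite ltrD2r ltr0_norm//; case: ifP => _; last by rewrite mule0.
  by rewrite -EFinB -EFinM; congr EFin; field.
- rewrite (_ : aff c t @^-1` _ = `](a - t) / c, (b - t) / c]%classic);
    last first.
    apply/seteqP; split => x /=; rewrite !in_itv/= ler_pdivlMr// ltr_pdivrMr//.
      by rewrite /aff => /andP[? ?]; apply/andP; split; lra.
    by rewrite /aff => /andP[? ?]; apply/andP; split; lra.
  rewrite lebesgue_measure_itv/= lte_fin ltr_pdivrMr// divfK//.
  rewrite ltrD2r gtr0_norm//; case: ifP => _; last by rewrite mule0.
  by rewrite -EFinB -EFinM; congr EFin; field.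
Qed.

Lemma ge0_integral_affine (c t : R) (g : measurableTypeR R -> \bar R) :
  c != 0 -> measurable_fun setT g -> (forall x, (0 <= g x)%E) ->
  (\int[mu]_x g x = `|c|%:E * \int[mu]_x g (c * x + t)%R)%E.
Proof.
move=> c0 mg g0.
pose nu := mscale (NngNum (normr_ge0 c)) (pushforward mu (aff c t)).
transitivity (\int[nu (measurable_aff c t)]_x g x)%E.
  apply: eq_measure_integral => A mA _; rewrite /nu /mscale/=.
  exact: lebesgue_measure_aff.
rewrite ge0_integral_mscale//=; congr (_ * _)%E.
by rewrite ge0_integral_pushforward.
Qed.

End affine_substitution.

(** * Integration against N(0,1) through its density *)

Section normal01.
Context {R : realType}.
Notation mu := (@lebesgue_measure R).
Notation N01 := (normal_prob (0 : R) 1).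
Notation p := (normal_pdf (0 : R) 1).

(** The Radon-Nikodym derivative and the density have the same integral over every measurable set,
    so they agree almost everywhere and can be exchanged under the integral. *)
Lemma ge0_integral_normal_prob (f : measurableTypeR R -> \bar R) :
  measurable_fun setT f -> (forall x, (0 <= f x)%E) ->
  (\int[N01]_x f x = \int[mu]_x (f x * (p x)%:E))%E.
Proof.
move=> mf f0; have dom := normal_prob_dominates (0 : R) 1.
rewrite -(Radon_Nikodym_SigmaFinite.change_of_variables dom)//.
have intf := Radon_Nikodym_SigmaFinite.f_integrable dom.
apply: ae_eq_integral => //.
- by apply: emeasurable_funM => //; apply: measurable_int intf.
- apply: emeasurable_funM => //; apply/measurable_EFinP.
  exact: measurable_normal_pdf.
- apply: ae_eqe_mul2l; apply: integral_ae_eq => //.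
  + by apply/measurable_EFinP; exact: measurable_normal_pdf.
  + by move=> E _ mE; rewrite -Radon_Nikodym_SigmaFinite.f_integral.
Qed.

End normal01.

(** * Invariance of a pair of independent N(0,1) variables under plane rotations *)

Section rotation2.
Context {R : realType}.
Notation mu := (@lebesgue_measure R).
Notation N01 := (normal_prob (0 : R) 1).
Notation p := (normal_pdf (0 : R) 1).
Notation T := (measurableTypeR R).

Definition rot2 (c s : R) (z : T * T) : T * T :=
  (c * z.1 - s * z.2, s * z.1 + c * z.2).

Lemma measurable_rot2 c s : measurable_fun setT (rot2 c s).
Proof.
have m1 : measurable_fun setT (fst : T * T -> R) by exact: measurable_fst.
have m2 : measurable_fun setT (snd : T * T -> R) by exact: measurable_snd.
apply: measurable_fun_pair => /=.
  by apply: measurable_funB; apply: measurable_funM.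
by apply: measurable_funD; apply: measurable_funM.
Qed.

(* Substitute v = s x + c y for fixed y, then u = (c v - y) / s for fixed v:
   the two Jacobians, 1/|s| and |s|, cancel. *)
Lemma integral2_rot2 (c s : R) (F : T * T -> \bar R) : s != 0 ->
  c ^+ 2 + s ^+ 2 = 1 -> measurable_fun setT F -> (forall z, (0 <= F z)%E) ->
  (\int[mu]_x \int[mu]_y F (rot2 c s (x, y))
   = \int[mu]_x \int[mu]_y F (x, y))%E.
Proof.
move=> s0 cs mF F0.
have maff a b : measurable_fun setT (fun x : T => a * x + b : T).
  by apply: measurable_funD => //; apply: measurable_funM.
pose G (z : T * T) := F ((c * z.2 - z.1) / s, z.2).
have mG : measurable_fun setT G.
  apply: measurableT_comp => //; apply: measurable_fun_pair => /=; last first.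
    exact: measurable_snd.
  apply: measurable_funM => //.
  apply: measurable_funB; last exact: measurable_fst.
  by apply: measurable_funM => //; exact: measurable_snd.
have G0 z : (0 <= G z)%E by exact: F0.
have ns0 : (`|s|%:E * `|s^-1|%:E = 1 :> \bar R)%E.
  by rewrite -EFinM -normrM divff// normr1.
rewrite (fubini_tonelli (F \o rot2 c s)); last 2 first.
- exact: (measurableT_comp mF (measurable_rot2 c s)).
- by move=> z; exact: F0.
rewrite [RHS](fubini_tonelli F mF F0).
have inner1 y : (\int[mu]_x F (rot2 c s (x, y))
    = `|s^-1|%:E * \int[mu]_v G (y, v))%E.
  rewrite (@ge0_integral_affine _ s (c * y) (fun v => G (y, v)))//; last first.
    exact: (measurableT_comp mG (pair1_measurable y)).
  rewrite muleA (muleC `|s^-1|%:E%E) ns0 mul1e.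
  apply: eq_integral => x _; rewrite /G /rot2/=; congr (F (_, _)).
  apply: (@mulIf _ s) => //; rewrite divfK//.
  by have /= := congr1 ( *%R^~ y) cs; lra.
have inner2 v : (\int[mu]_u F (u, v) = `|s^-1|%:E * \int[mu]_y G (y, v))%E.
  rewrite (@ge0_integral_affine _ (- s^-1) (c * v / s) (fun u => F (u, v)))//.
  - rewrite normrN; congr (_ * _)%E; apply: eq_integral => y _.
    by rewrite /G/=; congr (F (_, _)); ring.
  - by rewrite oppr_eq0 invr_eq0.
  - exact: (measurableT_comp mF (pair2_measurable v)).
under eq_integral do rewrite inner1.
under [RHS]eq_integral do rewrite inner2.
have mGG := measurable_fun_fubini_tonelli_G G mG G0.
have mGF := measurable_fun_fubini_tonelli_F G mG G0.
rewrite (ge0_integralZl mu measurableT (mGF mu)) => [||//]; last first.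
  by move=> x _; exact: integral_ge0.
rewrite (ge0_integralZl mu measurableT (mGG mu)) => [||//]; last first.
  by move=> x _; exact: integral_ge0.
congr (_ * _)%E; exact: (fubini_tonelli G mG G0).
Qed.

Lemma integral2_normal_prob (h : T * T -> \bar R) :
  measurable_fun setT h -> (forall z, (0 <= h z)%E) ->
  (\int[N01]_x \int[N01]_y h (x, y)
   = \int[mu]_x \int[mu]_y (h (x, y) * (p x * p y)%:E))%E.
Proof.
move=> mh h0.
have mp : measurable_fun setT (EFin \o p).
  by apply/measurable_EFinP; exact: measurable_normal_pdf.
rewrite ge0_integral_normal_prob//.
- apply: eq_integral => x _.
  rewrite ge0_integral_normal_prob//; last first.
    exact: (measurableT_comp mh (pair1_measurable x)).
  rewrite -ge0_integralZr//.
  + by apply: eq_integral => y _; rewrite -muleA -EFinM mulrC.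
  + apply: emeasurable_funM => //.
    exact: (measurableT_comp mh (pair1_measurable x)).
  + by move=> y _; rewrite mule_ge0// lee_fin normal_pdf_ge0.
  + by rewrite lee_fin normal_pdf_ge0.
- exact: measurable_fun_fubini_tonelli_F h mh h0.
- by move=> x; exact: integral_ge0.
Qed.

(** The joint density depends only on [x ^+ 2 + y ^+ 2], which the rotation preserves; it is
    absorbed into the integrand before Lebesgue measure is rotated. *)
Lemma integral2_normal_prob_rot2 (c s : R) (h : T * T -> \bar R) : s != 0 ->
  c ^+ 2 + s ^+ 2 = 1 -> measurable_fun setT h -> (forall z, (0 <= h z)%E) ->
  (\int[N01]_x \int[N01]_y h (rot2 c s (x, y))
   = \int[N01]_x \int[N01]_y h (x, y))%E.
Proof.
move=> s0 cs mh h0.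
have mp : measurable_fun setT p by exact: measurable_normal_pdf.
rewrite (@integral2_normal_prob (h \o rot2 c s)); last 2 first.
- exact: (measurableT_comp mh (measurable_rot2 c s)).
- by move=> z; exact: h0.
rewrite [RHS](integral2_normal_prob mh h0).
pose F (z : T * T) := (h z * (p z.1 * p z.2)%:E)%E.
have mF : measurable_fun setT F.
  apply: emeasurable_funM => //; apply/measurable_EFinP; apply: measurable_funM.
    exact: (measurableT_comp mp measurable_fst).
  exact: (measurableT_comp mp measurable_snd).
have F0 z : (0 <= F z)%E.
  by rewrite mule_ge0// lee_fin mulr_ge0// normal_pdf_ge0.
apply: (etrans _ (integral2_rot2 s0 cs mF F0)).
apply: eq_integral => x _; apply: eq_integral => y _; rewrite /F/=.
congr (_ * _%:E)%E; rewrite !normal_pdfE ?oner_eq0//.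
rewrite /normal_fun !subr0 mulrACA [RHS]mulrACA -!expRD; congr (_ * expR _).
by rewrite -!mulrDl -!opprD -[x ^+ 2 + _]mul1r -cs; congr (- _ / _); ring.
Qed.

(** The density is even. This handles a corner entry equal to -1 in [gauss_invariant_block]. *)
Lemma normal_prob01N (A : set T) : measurable A -> N01 (-%R @^-1` A) = N01 A.
Proof.
move=> mA.
have mp : measurable_fun setT (EFin \o p).
  by apply/measurable_EFinP; exact: measurable_normal_pdf.
rewrite /normal_prob integral_mkcond [RHS]integral_mkcond.
rewrite [RHS](@ge0_integral_affine _ (-1) 0)/=.
- rewrite normrN1 mul1e; apply: eq_integral => x _; rewrite mulN1r addr0.
  rewrite !patchE.
  have -> : (x \in -%R @^-1` A) = (- x \in A) by apply/idP/idP; rewrite !inE.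
  case: ifP => // _; congr EFin.
  by rewrite !normal_pdfE ?oner_eq0// /normal_fun !subr0 sqrrN.
- by rewrite oppr_eq0 oner_eq0.
- by apply/(measurable_restrictT _ mA); exact: measurable_funTS.
- move=> x; rewrite patchE; case: ifP => // _.
  by rewrite lee_fin normal_pdf_ge0.
Qed.

End rotation2.

(** * Invariance of the standard Gaussian law under orthogonal matrices *)

Section std_gauss_orthogonal.
Context {R : realType}.
Notation N01 := (normal_prob (0 : R) 1).
Notation T := (measurableTypeR R).

Lemma std_gaussS n (A : set 'rV[R]_n.+1) : measurable A ->
  std_gauss n.+1 A
  = (\int[N01]_x std_gauss n ((fun v => cons_rV (x, v)) @^-1` A))%E.
Proof.
move=> mA; apply: eq_integral => x _ /=; congr (std_gauss n _).
by apply/seteqP; split => v /=; rewrite /xsection/= inE.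
Qed.

Lemma measurable_cons_rV1 n (x : T) :
  measurable_fun setT (fun v : 'rV[R]_n => cons_rV (x, v)).
Proof.
exact: (measurableT_comp (@measurable_cons_rV R n) (pair1_measurable x)).
Qed.

Lemma measurable_std_gauss_section n (A : set 'rV[R]_n.+1) : measurable A ->
  measurable_fun setT (fun x : T =>
    std_gauss n ((fun v => cons_rV (x, v)) @^-1` A)).
Proof.
move=> mA; pose B := @cons_rV R n @^-1` A.
have mB : measurable B.
  by rewrite -[B]setTI; apply: (@measurable_cons_rV R n).
rewrite (_ : (fun x => _) = std_gauss n \o xsection B).
  exact: measurable_fun_xsection.
apply/funext => x /=; congr (std_gauss n _).
by apply/seteqP; split => v /=; rewrite /xsection/= inE.
Qed.

Lemma measurable_preimage d1 d2 (T1 : measurableType d1)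
    (T2 : measurableType d2) (f : T1 -> T2) (A : set T2) :
  measurable_fun setT f -> measurable A -> measurable (f @^-1` A).
Proof. by move=> mf mA; rewrite -[X in measurable X]setTI; exact: mf. Qed.

Lemma measurable_mulmxr n k (G : 'M[R]_(n, k)) :
  measurable_fun setT (fun v : 'rV[R]_n => v *m G).
Proof.
apply: measurable_fun_rV => j; under eq_fun do rewrite mxE.
apply: measurable_sum => i; apply: measurable_funM => //.
exact: measurable_coord.
Qed.

(** Links the recursive construction of the law to block matrices of size [1 + n], on which products
    are computed. *)
Lemma cons_rVE n (x : R) (v : 'rV[R]_n) :
  cons_rV (x, v) = row_mx x%:M v :> 'rV_(1 + n).
Proof.
apply/rowP => i; rewrite !mxE; case: splitP => j ij.
  rewrite (_ : i = ord0); last first.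
    by apply/val_inj; rewrite /= ij; case: j ij => -[].
  by rewrite unlift_none !ord1 mxE eqxx.
rewrite (_ : i = lift ord0 j); last by apply/val_inj; rewrite /= ij.
by rewrite liftK.
Qed.

Lemma cons_rV_surj n (u : 'rV[R]_n.+1) :
  exists x v, u = cons_rV (x, v).
Proof.
exists (u 0 0), (\row_i u 0 (lift ord0 i)).
apply/rowP => i; rewrite mxE; case: (unliftP ord0 i) => [j ->|->] //=.
by rewrite mxE.
Qed.

Lemma cons_rV_block n (x a : R) (v : 'rV[R]_n) (G : 'M[R]_n) :
  cons_rV (x, v) *m (block_mx a%:M 0 0 G : 'M[R]_(1 + n))
  = cons_rV (x * a, v *m G).
Proof.
rewrite !cons_rVE (@mul_row_block _ 1 1 n 1 n) !mulmx0 addr0 add0r.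
by rewrite scalar_mxM.
Qed.

Definition orthmx n (G : 'M[R]_n) := G *m G^T = 1%:M.

Definition gauss_invariant n (G : 'M[R]_n) := forall A, measurable A ->
  std_gauss n ((fun v : 'rV[R]_n => v *m G) @^-1` A) = std_gauss n A.

Lemma orthmx_mul n (G H : 'M[R]_n) : orthmx G -> orthmx H -> orthmx (G *m H).
Proof.
by move=> oG oH; rewrite /orthmx trmx_mul mulmxA -(mulmxA G) oH mulmx1.
Qed.

Lemma orthmx_block n (a : R) (G : 'M[R]_n) : a ^+ 2 = 1 -> orthmx G ->
  orthmx (block_mx a%:M 0 0 G : 'M[R]_(1 + n)).
Proof.
move=> a1 oG; rewrite /orthmx tr_block_mx !trmx0 tr_scalar_mx mulmx_block.
rewrite !(mulmx0, mul0mx, addr0, add0r) oG -scalar_mxM -expr2 a1.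
by rewrite -scalar_mx_block.
Qed.

Lemma gauss_invariant_mul n (G H : 'M[R]_n) :
  gauss_invariant G -> gauss_invariant H -> gauss_invariant (G *m H).
Proof.
move=> iG iH A mA; rewrite -[RHS]iH// -[RHS]iG; last first.
  by apply: measurable_preimage => //; exact: measurable_mulmxr.
by congr (std_gauss n _); apply/funext => v /=; rewrite mulmxA.
Qed.

(** Invariance under [G] allows the event for [H] to be pulled back by [G], and [G *m H] is the
    identity. *)
Lemma gauss_invariant_inv n (G H : 'M[R]_n) : G *m H = 1%:M ->
  gauss_invariant G -> gauss_invariant H.
Proof.
move=> GH iG A mA; rewrite -[LHS]iG; last first.
  by apply: measurable_preimage => //; exact: measurable_mulmxr.
by congr (std_gauss n _); apply/funext => v /=; rewrite -mulmxA GH mulmx1.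
Qed.

(** With the first coordinate fixed, the invariance of [G] applies. The first coordinate is
    multiplied by 1 or -1, and the sign is absorbed by the symmetry of N(0,1). *)
Lemma gauss_invariant_block n (a : R) (G : 'M[R]_n) : a ^+ 2 = 1 ->
  gauss_invariant G -> gauss_invariant (block_mx a%:M 0 0 G : 'M[R]_(1 + n)).
Proof.
move=> a1 iG A mA.
rewrite std_gaussS; last first.
  by apply: measurable_preimage => //; exact: measurable_mulmxr.
pose h (x : T) := std_gauss n ((fun v => cons_rV (x, v)) @^-1` A).
have mh : measurable_fun setT h by exact: measurable_std_gauss_section.
transitivity (\int[N01]_x h (x * a)%R)%E.
  apply: eq_integral => x _; rewrite /h -[RHS]iG; last first.
    by apply: measurable_preimage => //; exact: measurable_cons_rV1.
  congr (std_gauss n _); apply/seteqP.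
  by split => v /=; rewrite cons_rV_block.
rewrite std_gaussS//.
have /orP[/eqP->|/eqP->] : (a == 1) || (a == -1) by rewrite -sqrf_eq1 a1.
  by apply: eq_integral => x _; rewrite mulr1.
have mopp : measurable_fun setT (-%R : T -> T) by exact: measurable_funN.
transitivity (\int[pushforward N01 (-%R : T -> T)]_x h x)%E.
  rewrite ge0_integral_pushforward//.
  by apply: eq_integral => x _ /=; rewrite mulrN1.
by apply: eq_measure_integral => // B mB _; exact: normal_prob01N.
Qed.

(** The map [rot2] on the first two coordinates, laid out for row vectors multiplied on the
    right. *)
Definition rotmx n (c s : R) : 'M[R]_(1 + (1 + n), 1 + (1 + n)) :=
  block_mx c%:M (row_mx s%:M 0) (col_mx (- s)%:M 0)
    (block_mx c%:M 0 0 1%:M).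

Lemma cons_rV_rotmx n (c s x y : R) (v : 'rV[R]_n) :
  cons_rV (x, cons_rV (y, v)) *m rotmx n c s
  = cons_rV (c * x - s * y, cons_rV (s * x + c * y, v)).
Proof.
rewrite !cons_rVE (@mul_row_block _ 1 1 (1 + n) 1 (1 + n)) mul_mx_row.
rewrite (@mul_row_col _ 1 1 n 1) (@mul_row_block _ 1 1 n 1 n).
rewrite !(mulmx0, addr0, add0r, mulmx1) add_row_mx add0r.
rewrite -!scalar_mxM -!raddfD/=.
by congr (row_mx _%:M (row_mx _%:M _)); ring.
Qed.

Lemma orthmx_rotmx n (c s : R) : c ^+ 2 + s ^+ 2 = 1 -> orthmx (rotmx n c s).
Proof.
move=> cs; rewrite /orthmx /rotmx !(tr_block_mx, tr_row_mx, tr_col_mx).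
rewrite !(trmx0, tr_scalar_mx) mulmx_block mul_row_col mul_col_row mulmx_block.
rewrite mul_mx_row mul_col_mx mul_row_block mul_block_col.
rewrite !(mulmx0, mul0mx, addr0, add0r, mulmx1) -!scalar_mxM.
rewrite add_row_mx add_col_mx add_block_mx !addr0 !add0r -!raddfD/=.
rewrite (_ : c * c + s * s = 1) -?cs//.
rewrite (_ : c * - s + s * c = 0); last by ring.
rewrite (_ : - s * c + c * s = 0); last by ring.
rewrite (_ : - s * - s + c * c = 1) -?cs; last by ring.
by rewrite !raddf0 row_mx0 col_mx0 -!scalar_mx_block.
Qed.

Lemma gauss_invariant_rotmx n (c s : R) : s != 0 -> c ^+ 2 + s ^+ 2 = 1 ->
  gauss_invariant (rotmx n c s).
Proof.
move=> s0 cs A mA.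
pose cons2 (z : T * T) (v : 'rV[R]_n) := cons_rV (z.1, cons_rV (z.2, v)).
pose h z := std_gauss n (cons2 z @^-1` A).
have E B : measurable B -> std_gauss n.+2 B =
    (\int[N01]_x \int[N01]_y std_gauss n (cons2 (x, y) @^-1` B))%E.
  move=> mB; rewrite (std_gaussS mB); apply: eq_integral => x _.
  apply: std_gaussS; apply: measurable_preimage mB.
  exact: measurable_cons_rV1.
have mh : measurable_fun setT h.
  pose C := [set w : (T * T) * 'rV[R]_n | A (cons2 w.1 w.2)].
  have mC : measurable C.
    apply: (@measurable_preimage _ _ _ _ (fun w => cons2 w.1 w.2)) => //.
    apply: (measurableT_comp (@measurable_cons_rV R n.+1)).
    apply: measurable_fun_pair => /=.
      by apply: measurableT_comp => //; exact: measurable_fst.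
    apply: (measurableT_comp (@measurable_cons_rV R n)).
    apply: measurable_fun_pair => /=; last exact: measurable_snd.
    by apply: (measurableT_comp measurable_snd); exact: measurable_fst.
  rewrite (_ : h = std_gauss n \o xsection C).
    exact: measurable_fun_xsection.
  apply/funext => x /=; congr (std_gauss n _).
  by apply/seteqP; split => v /=; rewrite /xsection/= inE.
have h0 z : (0 <= h z)%E by exact: measure_ge0.
rewrite (E _ mA) (E _ (measurable_preimage (measurable_mulmxr _) mA)).
apply: (etrans _ (integral2_normal_prob_rot2 s0 cs mh h0)).
apply: eq_integral => x _; apply: eq_integral => y _.
congr (std_gauss n _); apply/seteqP.
by split => v /=; rewrite cons_rV_rotmx.
Qed.

(** Plane rotations clear the coordinates one at a time, the last ones first. Invariance is carried
    in the conclusion because the result for all orthogonal matrices is derived from this one. *)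
Lemma orthmx_to_axis n (u : 'rV[R]_n.+1) : exists (H : 'M[R]_n.+1) (t : R),
  [/\ orthmx H, gauss_invariant H & u *m H = cons_rV (t, 0)].
Proof.
elim: n u => [|n IH] u; have [x [v ->]] := cons_rV_surj u.
  exists 1%:M, x; split.
  - by rewrite /orthmx trmx1 mulmx1.
  - by move=> A mA; congr (std_gauss 1 _); apply/funext => w /=; rewrite mulmx1.
  - by rewrite mulmx1 (thinmx0 v).
have [H [t [oH iH vH]]] := IH v.
have one2 : (1 : R) ^+ 2 = 1 by rewrite expr1n.
have oK := orthmx_block one2 oH; have iK := gauss_invariant_block one2 iH.
set K := block_mx _ _ _ _ in oK iK.
have uK : cons_rV (x, v) *m K = cons_rV (x, cons_rV (t, 0)).
  by rewrite cons_rV_block mulr1 vH.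
have cons00 : cons_rV (0, 0) = 0 :> 'rV[R]_n.+1.
  by rewrite cons_rVE raddf0 row_mx0.
(* The rotation used below has sine [- (t / r)], and [gauss_invariant_rotmx] requires a nonzero
   sine. When [t] is 0 the vector is already on the axis. *)
have [t0|t0] := eqVneq t 0.
  by exists K, x; split => //; rewrite uK t0 cons00.
pose r := Num.sqrt (x ^+ 2 + t ^+ 2).
have r2 : r ^+ 2 = x ^+ 2 + t ^+ 2 by rewrite sqr_sqrtr// addr_ge0 ?sqr_ge0.
have r0 : r != 0.
  have : 0 < r ^+ 2 by rewrite r2 ltr_wpDl ?sqr_ge0// exprn_even_gt0.
  by apply: contraTneq => ->; rewrite expr0n ltxx.
have cs : (x / r) ^+ 2 + (- (t / r)) ^+ 2 = 1.
  by rewrite sqrrN !expr_div_n -mulrDl -r2 divff// expf_neq0.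
(* These values of cosine and sine send the pair (x, t) to (r, 0). *)
exists (K *m rotmx n (x / r) (- (t / r))), r; split.
- exact: orthmx_mul oK (orthmx_rotmx _ cs).
- apply: gauss_invariant_mul iK (gauss_invariant_rotmx _ cs).
  by rewrite oppr_eq0 mulf_neq0// invr_eq0.
- rewrite mulmxA uK cons_rV_rotmx -[in RHS]cons00.
  rewrite (_ : _ + x / r * t = 0); last by ring.
  congr (cons_rV (_, _)); apply: (@mulIf _ r) => //.
  by rewrite -[in RHS]expr2 r2; field.
Qed.

(** The first row has norm 1, which gives [t ^+ 2 = 1]; the other rows are orthogonal to it, which
    clears the rest of the first column. *)
Lemma orthmx_first_row n (K : 'M[R]_(1 + n)) (t : R) : orthmx K ->
  row_mx 1%:M 0 *m K = row_mx t%:M 0 ->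
  exists d : 'M[R]_n, [/\ orthmx d, t ^+ 2 = 1 & K = block_mx t%:M 0 0 d].
Proof.
rewrite /orthmx -(submxK K); set a := ulsubmx K; set b := ursubmx K.
set c := dlsubmx K; set d := drsubmx K => oK.
rewrite mul_row_block !mul0mx !addr0 !mul1mx => /eq_row_mx[aE bE].
move: oK; rewrite tr_block_mx mulmx_block aE bE.
rewrite !(trmx0, mulmx0, mul0mx, addr0) (scalar_mx_block 1 n) tr_scalar_mx.
move=> /eq_block_mx[tt _ ct dd].
have t1 : t ^+ 2 = 1.
  by have := congr1 (fun M : 'M[R]_1 => M 0 0) tt; rewrite -scalar_mxM !mxE.
have c0 : c = 0.
  have := congr1 (mulmx^~ t%:M) ct.
  by rewrite mul0mx -mulmxA -scalar_mxM -expr2 t1 mulmx1.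
by exists d; split => //; [move: dd; rewrite c0 mul0mx add0r|rewrite c0].
Qed.

(* Composing G with a product of plane rotations that brings its first row back
   to an axis leaves a block matrix, to which the induction applies. *)
Lemma orthmx_gauss_invariant n (G : 'M[R]_n) : orthmx G -> gauss_invariant G.
Proof.
elim: n G => [|n IH] G oG.
  move=> A mA; congr (std_gauss 0 _); apply/funext => w /=.
  by rewrite (thinmx0 (w *m G)) (thinmx0 w).
have [H [t [oH iH GH]]] := orthmx_to_axis (cons_rV (1, 0) *m G).
pose K := G *m H; have oK : orthmx K by exact: orthmx_mul.
have iHT : gauss_invariant H^T by exact: gauss_invariant_inv iH.
suff iK : gauss_invariant K.
  rewrite (_ : G = K *m H^T); first exact: gauss_invariant_mul.
  by rewrite /K -mulmxA oH mulmx1.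
rewrite -mulmxA -/K in GH.
rewrite !cons_rVE in GH.
have [d [od t1 ->]] := orthmx_first_row oK GH.
exact: gauss_invariant_block t1 (IH _ od).
Qed.

End std_gauss_orthogonal.

(** * Independence of complementary blocks of coordinates *)

Section std_gauss_split.
Context {R : realType}.
Notation N01 := (normal_prob (0 : R) 1).

Lemma measurable_lsubmx p q :
  measurable_fun setT (lsubmx : 'rV[R]_(p + q) -> 'rV[R]_p).
Proof.
apply: measurable_fun_rV => i; under eq_fun do rewrite mxE.
exact: measurable_coord.
Qed.

Lemma measurable_rsubmx p q :
  measurable_fun setT (rsubmx : 'rV[R]_(p + q) -> 'rV[R]_q).
Proof.
apply: measurable_fun_rV => i; under eq_fun do rewrite mxE.
exact: measurable_coord.
Qed.

(** Induction on [p]. The base case is a Dirac mass at the only vector of length 0; in the step,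
    [p.+1 + q] computes to [(p + q).+1], so the first coordinate is integrated out on both sides
    without a cast. *)
Lemma std_gauss_split p q (A : set 'rV[R]_p) (B : set 'rV[R]_q) :
  measurable A -> measurable B ->
  std_gauss (p + q)
    ((lsubmx : 'rV_(p + q) -> _) @^-1` A
     `&` (rsubmx : 'rV_(p + q) -> _) @^-1` B)
  = (std_gauss p A * std_gauss q B)%E.
Proof.
move=> + mB; elim: p A => [|p IH] A mA.
  rewrite [X in (X * _)%E](_ : _ = (0 \in A)%:R%:E); last exact: diracE.
  have rid (v : 'rV[R]_(0 + q)) : rsubmx v = v :> 'rV[R]_q.
    by apply/rowP => i; rewrite mxE; congr (v 0 _); apply/val_inj.
  have [A0|A0] := pselect (A 0).
    rewrite (mem_set A0) mul1e; congr (std_gauss q _); apply/seteqP.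
    split => v /=.
      by move=> [_]; rewrite rid.
    by rewrite rid (thinmx0 (@lsubmx _ _ 0 q v)).
  rewrite (memNset A0) mul0e (_ : _ `&` _ = set0) ?measure0//.
  by apply/seteqP; split => v //= -[]; rewrite (thinmx0 (@lsubmx _ _ 0 q v)).
have mC : measurable ((lsubmx : 'rV_(p.+1 + q) -> _) @^-1` A
    `&` (rsubmx : 'rV_(p.+1 + q) -> _) @^-1` B).
  by apply: measurableI; apply: measurable_preimage => //;
    [exact: measurable_lsubmx|exact: measurable_rsubmx].
rewrite (std_gaussS mA) (@std_gaussS _ (p + q) _ mC).
rewrite -ge0_integralZr//; last exact: measurable_std_gauss_section.
apply: eq_integral => x _; rewrite -IH; last first.
  by apply: measurable_preimage => //; exact: measurable_cons_rV1.
congr (std_gauss _ _); apply/seteqP.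
have lE (v : 'rV[R]_(p + q)) :
    lsubmx (cons_rV (x, v) : 'rV_(p.+1 + q)) = cons_rV (x, lsubmx v).
  apply/rowP => i; rewrite !mxE; case: (unliftP ord0 i) => [j|] ->.
    have -> : lshift q (lift ord0 j) = lift ord0 (lshift q (j : 'I_p))
      :> 'I_(p + q).+1 by exact/val_inj.
    by rewrite !liftK/= mxE.
  have -> : lshift q (ord0 : 'I_p.+1) = ord0 :> 'I_(p + q).+1 by exact/val_inj.
  by rewrite !unlift_none.
have rE (v : 'rV[R]_(p + q)) :
    rsubmx (cons_rV (x, v) : 'rV_(p.+1 + q)) = rsubmx v.
  apply/rowP => i; rewrite !mxE.
  have -> : rshift p.+1 i = lift ord0 (rshift p i) :> 'I_(p + q).+1.
    exact/val_inj.
  by rewrite liftK.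
by split => v /=; rewrite lE rE.
Qed.

(** The matrix [row_mx L K] is orthogonal, so [v *m L] and [v *m K] are jointly distributed as the
    two blocks of a standard Gaussian vector. *)
Lemma std_gauss_isometry_split n p q (L : 'M[R]_(n, p)) (K : 'M[R]_(n, q))
    (A : set 'rV[R]_p) (B : set 'rV[R]_q) : (p + q)%N = n ->
  L *m L^T + K *m K^T = 1%:M ->
  measurable A -> measurable B ->
  std_gauss n [set v | A (v *m L) /\ B (v *m K)]
  = (std_gauss p A * std_gauss q B)%E.
Proof.
move=> pq; subst n => LK mA mB; rewrite -std_gauss_split//.
have oG : orthmx (row_mx L K) by rewrite /orthmx tr_row_mx mul_row_col.
rewrite -[RHS](orthmx_gauss_invariant oG).
  by congr (std_gauss _ _); apply/seteqP; split => v /=;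
    rewrite mul_mx_row row_mxKl row_mxKr.
by apply: measurableI; apply: measurable_preimage => //;
  [exact: measurable_lsubmx|exact: measurable_rsubmx].
Qed.

End std_gauss_split.

(** * Orthonormal bases adapted to a subspace, and the orthogonal projector *)

Section orthonormal_frame.
Context {R : realType} {n : nat}.
Implicit Types (u v : 'rV[R]_n) (U : {vspace 'rV[R]_n}) (e : nat -> 'rV[R]_n).

Lemma dotvE u v : dotv u v = (u *m v^T) 0 0.
Proof. by rewrite mxE; apply: eq_bigr => i _; rewrite mxE. Qed.

Lemma dotvvC u v : dotv u v = dotv v u.
Proof. by apply: eq_bigr => i _; rewrite mulrC. Qed.

Lemma dotvv_ge0 u : 0 <= dotv u u.
Proof. by apply: sumr_ge0 => i _; rewrite -expr2 sqr_ge0. Qed.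

Lemma dotvv_eq0 u : (dotv u u == 0) = (u == 0).
Proof.
apply/idP/eqP => [|->]; last by rewrite linear0l.
rewrite psumr_eq0 => [/allP u0|i _]; last by rewrite -expr2 sqr_ge0.
apply/rowP => i; rewrite mxE; have := u0 i.
by rewrite mem_index_enum -expr2 sqrf_eq0 => /(_ isT)/eqP.
Qed.

Lemma sqr_enorm u : enorm u ^+ 2 = dotv u u.
Proof. by rewrite sqr_sqrtr// dotvv_ge0. Qed.

(** The equality of sizes is a hypothesis because the lemma is applied to a matrix of width
    [\dim U + (n - \dim U)], which does not compute to [n]. *)
Lemma mulmx_trmx_eq1 k (G : 'M[R]_(n, k)) : k = n ->
  G^T *m G = 1%:M -> G *m G^T = 1%:M.
Proof. by move=> kn; subst k; exact: mulmx1C. Qed.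

Lemma sqr_enormZ a u : enorm (a *: u) ^+ 2 = a ^+ 2 * enorm u ^+ 2.
Proof. by rewrite !sqr_enorm linearZl_LR linearZr_LR/= mulrA. Qed.

(** A sequence read up to [k] rather than a tuple, so that extending a family does not change its
    type. *)
Definition orthonormal k e := forall i j, (i < k)%N -> (j < k)%N ->
  dotv (e i) (e j) = (i == j)%:R.

Lemma dotv_sum_orthonormal k e (c : 'I_k -> R) (j : 'I_k) : orthonormal k e ->
  dotv (\sum_i c i *: e i) (e j) = c j.
Proof.
move=> oe; rewrite linear_sumlz (bigD1 j)//= linearZl_LR/= oe// eqxx mulr1.
rewrite big1 ?addr0// => i ij; rewrite linearZl_LR/= oe//.
by rewrite (negbTE ij : (i == j :> nat) = false) mulr0.
Qed.

(** A Gram-Schmidt step: for lack of dimension some vector of [U] lies outside the span of the first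
    [k] vectors, so its residual is nonzero and can be normalized. *)
Lemma orthonormal_extend U k e : orthonormal k e ->
  (forall i, (i < k)%N -> e i \in U) -> (k < \dim U)%N ->
  exists v, [/\ v \in U, dotv v v = 1 &
    forall i, (i < k)%N -> dotv v (e i) = 0].
Proof.
move=> oe eU kU; pose X := [seq e i | i <- iota 0 k].
have : ~~ (U <= <<X>>)%VS.
  apply: contraL kU => /dimvS UX; rewrite -leqNgt (leq_trans UX)//.
  by rewrite (leq_trans (dim_span X))// size_map size_iota.
move=> /subvPn[u uU uX]; pose w := u - \sum_(i < k) dotv u (e i) *: e i.
have we i : (i < k)%N -> dotv w (e i) = 0.
  move=> ik; rewrite linearBl/=.
  by rewrite (@dotv_sum_orthonormal _ _ _ (Ordinal ik))// subrr.
have w0 : w != 0.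
  apply: contra uX; rewrite subr_eq0 => /eqP->.
  apply: memv_suml => i _; apply: memvZ; apply: memv_span.
  by apply/mapP; exists (val i) => //; rewrite mem_iota/=.
have ww : dotv w w != 0 by rewrite dotvv_eq0.
have wU : w \in U.
  by rewrite memvB// memv_suml// => i _; rewrite memvZ// eU.
exists ((enorm w)^-1 *: w); split; first exact: memvZ.
  rewrite linearZl_LR linearZr_LR/= mulrA -invfM -expr2 sqr_enorm.
  by rewrite mulVf.
by move=> i ik; rewrite linearZl_LR/= we// mulr0.
Qed.

Lemma orthonormal_complete U k m e : orthonormal k e ->
  (forall i, (i < k)%N -> e i \in U) -> (k <= m <= \dim U)%N ->
  exists e', [/\ orthonormal m e', (forall i, (i < m)%N -> e' i \in U) &
    forall i, (i < k)%N -> e' i = e i].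
Proof.
move=> oe eU; elim: m => [|m IH] /andP[km mU].
  by exists e; move: km oe eU; rewrite leqn0 => /eqP->.
move: km; rewrite leq_eqVlt => /predU1P[<-|km]; first by exists e.
have [|e1 [oe1 e1U e1e]] := IH; first by rewrite -ltnS km ltnW.
have [v [vU vv ve]] := orthonormal_extend oe1 e1U mU.
exists (fun i => if (i < m)%N then e1 i else v); split.
- move=> i j; rewrite !ltnS (leq_eqVlt i) (leq_eqVlt j).
  move=> /predU1P[->|im] /predU1P[->|jm]; rewrite ?ltnn ?im ?jm ?eqxx//.
  + by rewrite ve// gtn_eqF.
  + by rewrite dotvvC ve// ltn_eqF.
  + exact: oe1.
- by move=> i _; case: ifP => [/e1U|].
- move=> i ik; rewrite (leq_trans ik)//; exact: e1e.
Qed.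

Lemma orthonormal_span U e : orthonormal (\dim U) e ->
  (forall i, (i < \dim U)%N -> e i \in U) ->
  <<[seq e i | i <- iota 0 (\dim U)]>>%VS = U.
Proof.
move=> oe eU; set X := [seq _ | _ <- _].
have sX : size X = \dim U by rewrite size_map size_iota.
apply/eqP; rewrite eqEdim; apply/andP; split.
  apply/span_subvP => _ /mapP[i + ->]; rewrite mem_iota/= add0n.
  exact: eU.
suff fX : free X by rewrite (eqP fX) sX.
have -> : X = [tuple e i | i < \dim U].
  by rewrite /X -[LHS]/(map e _) -val_enum_ord -map_comp.
apply/freeP => c c0 i.
have := @dotv_sum_orthonormal _ _ c i oe.
rewrite -[X in dotv X _](_ : \sum_i c i *: [tuple e i | i < \dim U]`_i = _).
  by rewrite c0 linear0l.
by apply: eq_bigr => j _; rewrite -tnth_nth tnth_mktuple.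
Qed.

Lemma orthproj_unique U u v : u \in U -> v \in orthov dotv U ->
  orthproj U (u + v) = u.
Proof.
move=> uU vU.
have UV0 : (U :&: orthov dotv U = 0)%VS.
  apply/eqP; rewrite -subv0; apply/subvP => w; rewrite memv_cap memv0.
  by move=> /andP[wU /mem_orthovP/(_ _ wU)/eqP]; rewrite dotvv_eq0.
rewrite /orthproj linearD/= (daddv_pi_id UV0 uU).
(* The two components of [v] in the direct sum add up to [v], and the one in the orthogonal
   complement is [v] itself, so the one in [U] is 0. *)
have := daddv_pi_add UV0 (subvP (addvSr _ _) _ vU).
rewrite [X in _ + X]daddv_pi_id//; last by rewrite capvC.
by move=> /(canRL (addrK _)); rewrite subrr => ->; rewrite addr0.
Qed.

Lemma exists_frame U : exists (L : 'M[R]_(n, \dim U))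
    (K : 'M[R]_(n, n - \dim U)),
  [/\ L^T *m L = 1%:M, L^T *m K = 0, L *m L^T + K *m K^T = 1%:M,
      forall y, orthproj U y = y *m L *m L^T & forall y, y \in U -> y *m K = 0].
Proof.
have dimn : \dim {: 'rV[R]_n} = n by rewrite dimvf /dim/= mul1n.
have Un : (\dim U <= n)%N by rewrite -[leqRHS]dimn dimvS// subvf.
(* The empty family is completed to a basis of [U], and then that basis to one of the whole space;
   the vectors added second are orthogonal to [U]. *)
have [//|//||e1 [oe1 e1U _]] :=
  @orthonormal_complete U 0 (\dim U) (fun=> 0); first by rewrite leq0n leqnn.
have [||e [oe _ ee1]] := @orthonormal_complete fullv _ n _ oe1.
- by move=> i _; rewrite memvf.
- by rewrite dimn Un leqnn.
have eU i : (i < \dim U)%N -> e i \in U by move=> iU; rewrite ee1// e1U.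
have oeU : orthonormal (\dim U) e.
  by move=> i j iU jU; rewrite oe// (leq_trans _ Un).
have eN j : (\dim U <= j < n)%N -> e j \in orthov dotv U.
  move=> /andP[Uj jn]; rewrite mem_orthov_sym -(orthonormal_span oeU eU).
  apply/span_subvP => _ /mapP[i + ->]; rewrite mem_iota/= add0n => iU.
  have ij : dotv (e i) (e j) = 0.
    by rewrite oe ?ltn_eqF ?(leq_trans iU)// (leq_trans Uj)// ltnW.
  by rewrite mem_orthov1; apply/eqP.
pose L := \matrix_(i < n, j < \dim U) e j 0 i.
pose K := \matrix_(i < n, j < n - \dim U) e (\dim U + j)%N 0 i.
have Kn (j : 'I_(n - \dim U)) : (\dim U + j < n)%N by rewrite -ltn_subRL.
have LL : L^T *m L = 1%:M.
  apply/matrixP => i j; rewrite !mxE -(oeU _ _ (ltn_ord i) (ltn_ord j)).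
  by apply: eq_bigr => k _; rewrite !mxE.
have KK : K^T *m K = 1%:M.
  apply/matrixP => i j; rewrite !mxE.
  have -> : (i == j) = (\dim U + i == \dim U + j)%N by rewrite eqn_add2l.
  rewrite -(oe _ _ (Kn i) (Kn j)).
  by apply: eq_bigr => k _; rewrite !mxE.
have LK : L^T *m K = 0.
  apply/matrixP => i j; rewrite !mxE.
  have := oe i (\dim U + j)%N (leq_trans (ltn_ord i) Un) (Kn j).
  rewrite ltn_eqF ?(leq_trans (ltn_ord i))// ?leq_addr// => oij.
  by apply: etrans oij; apply: eq_bigr => k _; rewrite !mxE.
have LLKK : L *m L^T + K *m K^T = 1%:M.
  (* Orthonormality of the columns gives this product; since the matrix is square, the product in
     the other order is the identity too. *)
  have GG : (row_mx L K)^T *m row_mx L K = 1%:M.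
    rewrite tr_row_mx mul_col_row LL KK LK -[K^T *m L]trmxK trmx_mul trmxK LK.
    by rewrite trmx0 -scalar_mx_block.
  by rewrite -mul_row_col -tr_row_mx mulmx_trmx_eq1// subnKC.
have yL y : y *m L *m L^T \in U.
  rewrite (_ : _ *m _ = \sum_(j < \dim U) (y *m L) 0 j *: e j); last first.
    by apply/rowP => i; rewrite mxE summxE; apply: eq_bigr => j _; rewrite !mxE.
  by apply: memv_suml => j _; rewrite memvZ// eU.
have yK y : y *m K *m K^T \in orthov dotv U.
  rewrite (_ : _ *m _ = \sum_(j < n - \dim U) (y *m K) 0 j *: e (\dim U + j)%N).
    apply: memv_suml => j _; rewrite memvZ// eN// leq_addr/=; exact: Kn.
  by apply/rowP => i; rewrite mxE summxE; apply: eq_bigr => j _; rewrite !mxE.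
exists L, K; split => // y.
  rewrite -[in LHS](mulmx1 y) -LLKK mulmxDr !mulmxA.
  exact: orthproj_unique.
move=> yU; apply/rowP => j; rewrite !mxE.
have ejU : e (\dim U + j)%N \in orthov dotv U.
  by rewrite eN// leq_addr/=; exact: Kn.
have ey : dotv (e (\dim U + j)%N) y = 0 by exact: (elimT mem_orthovP ejU).
by apply: etrans ey; apply: eq_bigr => k _; rewrite !mxE mulrC.
Qed.

End orthonormal_frame.

(** * Mass of intervals under N(0,1) *)

Section normal01_intervals.
Context {R : realType}.
Notation mu := (@lebesgue_measure R).
Notation N01 := (normal_prob (0 : R) 1).
Notation p := (normal_pdf (0 : R) 1).
Notation T := (measurableTypeR R).

Let measurable_p (A : set T) : measurable_fun A (EFin \o p).
Proof.
apply: measurable_funTS; apply/measurable_EFinP.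
exact: measurable_normal_pdf.
Qed.

Lemma le_normal_pdf (x y : R) : y ^+ 2 <= x ^+ 2 -> p x <= p y.
Proof.
move=> yx; rewrite !normal_pdfE ?oner_eq0// ler_wpM2l ?normal_peak_ge0//.
by rewrite /normal_fun !subr0 ler_expR ler_wpM2r ?lerN2.
Qed.

(** On the interval the density is at least its value at the larger of [|a|] and [|b|]. *)
Lemma normal_prob_itv_gt0 (a b : R) : a < b -> (0 < N01 `[a, b]%classic)%E.
Proof.
move=> ab; pose m := Num.max `|a| `|b|.
have pm0 : 0 < p m.
  rewrite normal_pdfE ?oner_eq0// mulr_gt0 ?expR_gt0//.
  by rewrite normal_peak_gt0// oner_eq0.
apply: (@lt_le_trans _ _ (\int[mu]_(x in `[a, b]%classic) (p m)%:E)%E).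
  rewrite integral_cst//= lebesgue_measure_itv/= lte_fin ab -EFinB -EFinM.
  by rewrite lte_fin mulr_gt0// subr_gt0.
apply: ge0_le_integral => //.
- by move=> x _; rewrite lee_fin ltW.
- move=> x /=; rewrite in_itv/= => /andP[ax xb]; rewrite lee_fin.
  have am : `|a| <= m by rewrite le_max lexx.
  have bm : `|b| <= m by rewrite le_max lexx orbT.
  have := ler_norm b; have := ler_norm (- a); rewrite normrN => na nb.
  have : 0 <= (m - x) * (m + x) by apply: mulr_ge0; lra.
  by move=> mx; apply: le_normal_pdf; lra.
Qed.

Lemma normal_prob_set1 (a : R) : N01 [set a] = 0%E.
Proof.
apply: (null_set_integral (mu := mu)) => //.
exact: lebesgue_measure_set1.
Qed.

(* Reflecting at the midpoint of -s and -s' exchanges the two intervals and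
   moves the part of the farther one outside the nearer one closer to 0. *)
Lemma normal_prob_shift_le (s s' t : R) : 0 <= s -> s <= s' ->
  (N01 `[(- s' - t)%R, (- s' + t)%R]%classic
   <= N01 `[(- s - t)%R, (- s + t)%R]%classic)%E.
Proof.
move=> s0 ss'; set I' := `[_, _]%classic; set I := `[- s - t, _]%classic.
have mI : measurable I by exact: measurable_itv.
have mI' : measurable I' by exact: measurable_itv.
rewrite (measureDI N01 mI' mI) [leRHS](measureDI N01 mI mI') (setIC I).
have NE (A : set T) : N01 A = (\int[mu]_x ((fun x => (p x)%:E) \_ A) x)%E.
  exact: integral_mkcond.
apply: leeD => //; rewrite [leLHS]NE [leRHS]NE.
have mr (A : set T) : measurable A ->
    measurable_fun setT ((fun x => (p x)%:E) \_ A).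
  by move=> mA; apply/(measurable_restrictT _ mA); exact: measurable_p.
have r0 (A : set T) x : (0 <= ((fun x => (p x)%:E) \_ A) x)%E.
  by rewrite patchE; case: ifP => // _; rewrite lee_fin normal_pdf_ge0.
have mII' := measurableD mI mI'; have mI'I := measurableD mI' mI.
rewrite [leRHS](@ge0_integral_affine _ (-1) (- (s + s')))//; last exact: mr.
rewrite normrN1 mul1e; apply: ge0_le_integral => //; first exact: mr.
  apply: (measurableT_comp (mr _ mII')).
  by apply: measurable_funD => //; apply: measurable_funM.
move=> x _; rewrite [leLHS]patchE; case: ifPn => [|_]; last exact: r0.
rewrite inE /I /I'/= !in_itv/= => -[/andP[x1 x2] /negP].
rewrite negb_and -!ltNge => x3.
have {}x3 : x < - s - t by case/orP: x3 => // ?; lra.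
rewrite patchE mem_set/=; last first.
  rewrite /I /I'/= !in_itv/=; split; first by apply/andP; split; lra.
  by apply/negP; rewrite negb_and -!ltNge; apply/orP; right; lra.
by rewrite lee_fin; apply: le_normal_pdf; nra.
Qed.

End normal01_intervals.

(** * Noncentral chi-square cdf and quantiles *)

Section chi2.
Context {R : realType}.
Notation N01 := (normal_prob (0 : R) 1).

Lemma measurable_sqr_enorm n (u : 'rV[R]_n) :
  measurable_fun setT (fun v : 'rV[R]_n => enorm (u + v) ^+ 2).
Proof.
under eq_fun do rewrite sqr_enorm.
apply: measurable_sum => i.
have mi : measurable_fun setT (fun v : 'rV[R]_n => (u + v) 0 i).
  under eq_fun do rewrite mxE.
  by apply: measurable_funD => //; exact: measurable_coord.
exact: measurable_funM.
Qed.

Lemma measurable_enorm_le n (u : 'rV[R]_n) (x : R) :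
  measurable [set v : 'rV[R]_n | enorm (u + v) ^+ 2 <= x].
Proof.
rewrite (_ : mkset _ = (fun v => enorm (u + v) ^+ 2) @^-1` `]-oo, x]).
  by apply: measurable_preimage => //; exact: measurable_sqr_enorm.
by apply/seteqP; split => v /=; rewrite in_itv.
Qed.

Lemma measurable_box n (A : 'I_n -> set R) : (forall i, measurable (A i)) ->
  measurable [set v : 'rV[R]_n | forall i, A i (v 0 i)].
Proof.
move=> mA; rewrite (_ : mkset _ =
    \bigcap_i ((fun v : 'rV[R]_n => v 0 i) @^-1` A i)).
  apply: fin_bigcap_measurable => // i _.
  by apply: measurable_preimage => //; exact: measurable_coord.
by apply/seteqP; split => v /= h i; [move=> _|]; exact: h.
Qed.

Lemma chi2_cdfE z d x : (chi2_cdf z d x)%:E =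
  std_gauss d [set xi : 'rV[R]_d | enorm (chi2_mean z d + xi) ^+ 2 <= x].
Proof. by rewrite fineK// fin_num_measure//; exact: measurable_enorm_le. Qed.

Lemma chi2_cdf_ge0 z d x : 0 <= chi2_cdf z d x :> R.
Proof. by rewrite -lee_fin chi2_cdfE. Qed.

Lemma dotv_orthmx n (G : 'M[R]_n) (u v : 'rV[R]_n) : orthmx G ->
  dotv (u *m G) (v *m G) = dotv u v.
Proof. by move=> oG; rewrite !dotvE trmx_mul mulmxA -(mulmxA u) oG mulmx1. Qed.

Lemma chi2_mean0 d : chi2_mean 0 d = 0 :> 'rV[R]_d.
Proof. by apply/rowP => i; rewrite !mxE sqrtr0; case: ifP. Qed.

Lemma chi2_meanS z d :
  chi2_mean z d.+1 = cons_rV (Num.sqrt z, 0) :> 'rV[R]_d.+1.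
Proof.
apply/rowP => i; rewrite !mxE; case: (unliftP ord0 i) => [j ->|->]//=.
by rewrite mxE.
Qed.

Lemma dotv_cons_rV n (x y : R) (u v : 'rV[R]_n) :
  dotv (cons_rV (x, u)) (cons_rV (y, v)) = x * y + dotv u v.
Proof.
rewrite /dotv big_ord_recl !mxE !unlift_none; congr (_ + _).
by apply: eq_bigr => i _; rewrite !mxE !liftK.
Qed.

Lemma cons_rVD n (x y : R) (u v : 'rV[R]_n) :
  cons_rV (x, u) + cons_rV (y, v) = cons_rV (x + y, u + v).
Proof.
apply/rowP => i; rewrite !mxE.
by case: (unlift ord0 i) => [j|] //=; rewrite mxE.
Qed.

(** [orthmx_to_axis] leaves the sign of the remaining coordinate free, while [chi2_mean] has a
    nonnegative one; the block with corner [a] corrects the sign. *)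
Lemma orthmx_to_chi2_mean d (mu : 'rV[R]_d) : exists H : 'M[R]_d,
  orthmx H /\ mu *m H = chi2_mean (dotv mu mu) d.
Proof.
case: d mu => [|d] mu.
  by exists 1%:M; split; [rewrite /orthmx trmx1 mulmx1|by apply/rowP => -[]].
have [H [t [oH _ muH]]] := orthmx_to_axis mu.
pose a : R := if 0 <= t then 1 else -1.
have a1 : a ^+ 2 = 1 by rewrite /a; case: ifP; rewrite ?sqrrN expr1n.
have o1 : orthmx (1%:M : 'M[R]_d) by rewrite /orthmx trmx1 mulmx1.
exists (H *m (block_mx a%:M 0 0 1%:M : 'M[R]_(1 + d))); split.
  exact: orthmx_mul oH (orthmx_block a1 o1).
rewrite mulmxA muH cons_rV_block mulmx1 chi2_meanS -(dotv_orthmx mu mu oH) muH.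
rewrite dotv_cons_rV linear0l addr0 -expr2 sqrtr_sqr; congr (cons_rV (_, _)).
rewrite /a; case: ifPn => [t0|]; first by rewrite mulr1 ger0_norm.
by rewrite -ltNge mulrN1 => /ltr0_norm.
Qed.

Lemma std_gauss_enorm_le d (mu : 'rV[R]_d) (x : R) :
  std_gauss d [set xi | enorm (mu + xi) ^+ 2 <= x]
  = (chi2_cdf (dotv mu mu) d x)%:E.
Proof.
have [H [oH muH]] := orthmx_to_chi2_mean mu.
rewrite chi2_cdfE -[RHS](orthmx_gauss_invariant oH); last first.
  exact: measurable_enorm_le.
congr (std_gauss d _); apply/seteqP.
by split => v /=; rewrite -muH -mulmxDl !sqr_enorm dotv_orthmx.
Qed.

Lemma chi2_cdf_gt0 z d (x : R) : 0 < x -> 0 < chi2_cdf z d x.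
Proof.
move=> x0; rewrite -lte_fin chi2_cdfE.
(* The cube of half-side [r] centered at minus the mean lies in the ball, since [d] times [r ^+ 2]
   is at most [x]. Dividing by [d.+1] avoids a division by 0 when [d] is 0. *)
pose r := Num.sqrt (x / d.+1%:R).
have xd0 : 0 < x / d.+1%:R by rewrite divr_gt0.
have r0 : 0 < r by rewrite sqrtr_gt0.
pose A (i : 'I_d) : set R :=
  `[- chi2_mean z d 0 i - r, - chi2_mean z d 0 i + r]%classic.
have mA i : measurable (A i) by exact: measurable_itv.
apply: (@lt_le_trans _ _ (std_gauss d [set v | forall i, A i (v 0 i)])).
  rewrite (std_gauss_box mA).
  rewrite (big_ind (fun x : \bar R => 0 < x)%E)//.
    by move=> ? ? ? ?; exact: mule_gt0.
  by move=> i _; apply: normal_prob_itv_gt0; lra.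
apply: le_measure; rewrite ?inE.
- exact: measurable_box.
- exact: measurable_enorm_le.
- move=> v /= vA; rewrite sqr_enorm.
  apply: (@le_trans _ _ (\sum_(i < d) x / d.+1%:R)); last first.
    rewrite sumr_const card_ord -[leLHS]mulr_natr mulrAC ler_pdivrMr//.
    by rewrite ler_pM2l// ler_nat.
  have <- : r ^+ 2 = x / d.+1%:R by rewrite sqr_sqrtr// ltW.
  apply: ler_sum => i _; have := vA i; rewrite /A/= in_itv/= => /andP[].
  have -> : (chi2_mean z d + v) 0 i = chi2_mean z d 0 i + v 0 i by rewrite mxE.
  move: (chi2_mean z d 0 i) (v 0 i) => c y cy1 cy2.
  have : 0 <= (r - (c + y)) * (r + (c + y)) by apply: mulr_ge0; lra.
  by lra.
Qed.

Lemma chi2_cdf_le0 d (x : R) : (0 < d)%N -> x <= 0 -> chi2_cdf 0 d x = 0.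
Proof.
case: d => // d _ x0; apply/eqP; rewrite eq_le chi2_cdf_ge0 andbT -lee_fin.
rewrite chi2_cdfE chi2_mean0.
have mA (i : 'I_d.+1) : measurable [set (0 : R)] by [].
have A0 :
    std_gauss d.+1 [set v : 'rV[R]_d.+1 | forall i, [set 0] (v 0 i)] = 0%E.
  by rewrite (std_gauss_box mA) big_ord_recl normal_prob_set1 mul0e.
rewrite -[leRHS]A0; apply: le_measure; rewrite ?inE.
- exact: measurable_enorm_le.
- exact: measurable_box mA.
- move=> v /=; rewrite add0r sqr_enorm => vx i.
  suff /eqP -> : v == 0 by rewrite mxE.
  by rewrite -dotvv_eq0 eq_le dotvv_ge0 (le_trans vx).
Qed.

(** The event forces the first coordinate of the noise below [Num.sqrt x - Num.sqrt z], whose normal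
    cdf tends to 0 as [z] grows. *)
Lemma chi2_cdf_vanish d (x e : R) : (0 < d)%N -> 0 < e ->
  exists2 z0 : R, 0 <= z0 & forall z, z0 <= z -> chi2_cdf z d x <= e.
Proof.
case: d => // d _ e0.
have H := isMeasurableFun.Build _ _ _ _ _ (@measurable_coord R d.+1 ord0).
pose X : {RV (std_gauss d.+1 : probability _ R) >-> R} :=
  HB.pack (fun v : 'rV[R]_d.+1 => v 0 ord0) H.
have /fine_cvgP[_] := cvg_cdfNy0 X.
move=> /cvgr0Pnorm_le/(_ e e0)[a [_ ale]].
(* Beyond this value [Num.sqrt x - Num.sqrt z] is at most [- |a| - 1], hence below [a]. *)
exists ((Num.sqrt x + `|a| + 1) ^+ 2); first exact: sqr_ge0.
move=> z z0.
have sz : Num.sqrt x + `|a| + 1 <= Num.sqrt z.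
  by rewrite -[leLHS]ger0_norm ?addr_ge0 ?sqrtr_ge0// -sqrtr_sqr ler_wsqrtr.
have /ale : Num.sqrt x - Num.sqrt z < a.
  by have := ler_norm (- a); rewrite normrN; lra.
apply: le_trans; apply: le_trans (ler_norm _); apply: fine_le.
- by rewrite fin_num_measure//; exact: measurable_enorm_le.
- by rewrite /cdf fin_num_measure.
apply: le_measure; rewrite ?inE.
- exact: measurable_enorm_le.
- by apply: measurable_preimage => //; exact: measurable_coord.
- move=> v /=; rewrite chi2_meanS; have [y [w ->]] := cons_rV_surj v.
  rewrite cons_rVD sqr_enorm dotv_cons_rV => h.
  rewrite /X/= in_itv/= mxE unlift_none/=.
  have : (Num.sqrt z + y) ^+ 2 <= x.
    by apply: le_trans h; rewrite expr2 lerDl dotvv_ge0.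
  move=> /(ler_wsqrtr); rewrite sqrtr_sqr => /(le_trans (ler_norm _)); lra.
Qed.

(** Integrates the first coordinate innermost, because [chi2_mean] shifts that coordinate only. *)
Lemma std_gaussS_swap n (A : set 'rV[R]_n.+1) : measurable A ->
  std_gauss n.+1 A
  = (\int[std_gauss n]_v N01 ((fun x => cons_rV (x, v)) @^-1` A))%E.
Proof.
move=> mA; pose B := @cons_rV R n @^-1` A.
have mB : measurable B.
  by apply: measurable_preimage mA; exact: measurable_cons_rV.
apply: (etrans _ (etrans (indic_fubini_tonelli N01 (std_gauss n) mB) _)).
  apply: eq_integral => x _; apply/esym.
  exact: (congr1 (@^~ x) (indic_fubini_tonelli_FE (std_gauss n) mB)).
apply: eq_integral => v _.
apply: etrans (congr1 (@^~ v) (indic_fubini_tonelli_GE N01 mB)) _ => /=.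
congr (N01 _); apply/seteqP.
by split => y /=; rewrite /ysection/= inE.
Qed.

Lemma measurable_std_gauss_ysection n (A : set 'rV[R]_n.+1) : measurable A ->
  measurable_fun setT (fun v : 'rV[R]_n =>
    N01 ((fun x : measurableTypeR R => cons_rV (x, v)) @^-1` A)).
Proof.
move=> mA; pose B := @cons_rV R n @^-1` A.
have mB : measurable B.
  by apply: measurable_preimage mA; exact: measurable_cons_rV.
rewrite (_ : (fun v => _) = N01 \o ysection B).
  exact: measurable_fun_ysection.
apply/funext => v /=; congr (N01 _).
by apply/seteqP; split => y /=; rewrite /ysection/= inE.
Qed.

(** With the other coordinates fixed, the first one ranges over an interval centered at
    [- Num.sqrt z] whose length does not depend on [z]. Moving the center away from 0 lowers its
    normal mass. *)
Lemma chi2_cdf_antitone d (x z z' : R) : 0 <= z -> z <= z' ->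
  chi2_cdf z' d x <= chi2_cdf z d x.
Proof.
move=> z0 zz'; rewrite -lee_fin !chi2_cdfE; case: d => [|d].
  by rewrite (thinmx0 (chi2_mean z' 0)) (thinmx0 (chi2_mean z 0)).
have mE (w : R) := measurable_enorm_le (chi2_mean w d.+1) x.
rewrite (std_gaussS_swap (mE _)) (std_gaussS_swap (mE _)).
have secE (w : R) (v : 'rV[R]_d) :
    (fun y : measurableTypeR R => cons_rV (y, v)) @^-1`
      [set xi : 'rV[R]_d.+1 | enorm (chi2_mean w d.+1 + xi) ^+ 2 <= x]
    = if 0 <= x - dotv v v then
        `[- Num.sqrt w - Num.sqrt (x - dotv v v),
          - Num.sqrt w + Num.sqrt (x - dotv v v)]%classic
      else set0.
  apply/seteqP; split => y /=; rewrite chi2_meanS cons_rVD add0r sqr_enorm;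
    rewrite dotv_cons_rV.
  - move=> h; have sq : (Num.sqrt w + y) ^+ 2 <= x - dotv v v by lra.
    rewrite (le_trans _ sq) ?sqr_ge0//= in_itv/=.
    have := ler_wsqrtr sq; rewrite sqrtr_sqr ler_norml => /andP[? ?].
    by apply/andP; split; lra.
  - case: ifPn => // c0; rewrite /= in_itv/= => /andP[y1 y2].
    have : 0 <= (Num.sqrt (x - dotv v v) - (Num.sqrt w + y))
        * (Num.sqrt (x - dotv v v) + (Num.sqrt w + y)) by apply: mulr_ge0; lra.
    rewrite -subr_sqr sqr_sqrtr//; lra.
apply: ge0_le_integral.
- exact: measurableT.
- by move=> v _; exact: measure_ge0.
- exact: (measurable_std_gauss_ysection (mE z')).
- exact: (measurable_std_gauss_ysection (mE z)).
- move=> v _; rewrite !secE; case: ifP => _; last by rewrite !measure0.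
  by apply: normal_prob_shift_le; [exact: sqrtr_ge0|exact: ler_wsqrtr].
Qed.

Lemma chi2_quantile_antitone z d (u u' : R) : u <= u' ->
  (chi2_quantile z d u' <= chi2_quantile z d u)%E.
Proof.
move=> uu'; apply: ereal_inf_le_tmp => _ [x /= ux <-]; exists x => //=.
by apply: le_trans ux; lra.
Qed.

Lemma chi2_quantile1 z d : chi2_quantile z d (1 : R) = -oo%E.
Proof.
have lb x : (chi2_quantile z d 1 <= x%:E)%E.
  by apply: ereal_inf_lbound; exists x => //=; rewrite subrr chi2_cdf_ge0.
case: (chi2_quantile z d 1) lb => [r|/(_ 0)|]//.
by move=> /(_ (r - 1)); rewrite leNgt lte_fin ltrBlDr ltrDl ltr01.
Qed.

(** The infimum is at least 0 because the central cdf vanishes at negative arguments, finite because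
    the cdf tends to 1, and attained because the cdf is right continuous. *)
Lemma chi2_quantileP d (u : R) : 0 < u < 1 ->
  exists q : R, chi2_quantile 0 d u = q%:E /\ 1 - u <= chi2_cdf 0 d q.
Proof.
move=> /andP[u0 u1].
have H := isMeasurableFun.Build _ _ _ _ _
  (measurable_sqr_enorm (chi2_mean 0 d : 'rV[R]_d)).
pose Y : {RV (std_gauss d : probability _ R) >-> R} := HB.pack
  (fun v : 'rV[R]_d => enorm (chi2_mean 0 d + v) ^+ 2) H.
have cdfY r : cdf Y r = (chi2_cdf 0 d r)%:E.
  rewrite chi2_cdfE /cdf /distribution /pushforward.
  by congr (std_gauss d _); apply/predeqP => v /=; rewrite in_itv.
have Fmono (r s : R) : r <= s -> chi2_cdf 0 d r <= chi2_cdf 0 d s.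
  by move=> rs; rewrite -lee_fin -!cdfY cdf_nondecreasing.
have F0 (r : R) : r < 0 -> chi2_cdf 0 d r = 0.
  move=> r0; apply: EFin_inj.
  rewrite chi2_cdfE (_ : mkset _ = set0) ?measure0//.
  apply/seteqP; split => v //= vr.
  by move: r0; rewrite ltNge (le_trans _ vr)// sqr_ge0.
have [r0 Fr0] : exists r0 : R, 1 - u <= chi2_cdf 0 d r0.
  have /fine_cvgP[_ /cvgr_ge] := cvg_cdfy1 Y.
  have u1' : 1 - u < 1 by lra.
  move=> /(_ _ u1')[a [_ age]].
  by exists (a + 1); have := age (a + 1); rewrite /= cdfY; apply; lra.
set q := chi2_quantile 0 d u.
have q0 : (0 <= q)%E.
  apply: le_ereal_inf_tmp => _ [r /= ur <-]; rewrite lee_fin leNgt.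
  by apply: contraTN ur => /F0 ->; rewrite -ltNge; lra.
have qr0 : (q <= r0%:E)%E by apply: ereal_inf_lbound; exists r0.
have qE : q = (fine q)%:E.
  by rewrite fineK// ge0_fin_numE// (le_lt_trans qr0)// ltry.
exists (fine q); split => //; rewrite -lee_fin -cdfY.
have rc := @cdf_right_continuous _ _ _ _ Y (fine q).
apply: (cvge_to_ge rc).
near=> r; have : (q < r%:E)%E.
  by rewrite qE lte_fin; near: r; exact: nbhs_right_gt.
move=> /ereal_inf_lt[_ [x /= ux <-]]; rewrite lte_fin => xr.
by rewrite cdfY lee_fin (le_trans ux)// Fmono// ltW.
Unshelve. all: by end_near. Qed.

End chi2.

(** * Residual and loss in an adapted frame *)

Section projection_norms.
Context {R : realType} {n : nat}.
Variables (U : {vspace 'rV[R]_n}) (L : 'M[R]_(n, \dim U))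
  (K : 'M[R]_(n, n - \dim U)).
Hypotheses (LL : L^T *m L = 1%:M) (LK : L^T *m K = 0)
  (LLKK : L *m L^T + K *m K^T = 1%:M)
  (projE : forall y, orthproj U y = y *m L *m L^T).

Lemma dotv_frame w : dotv w w = dotv (w *m L) (w *m L) + dotv (w *m K) (w *m K).
Proof.
rewrite !dotvE -[X in X *m w^T]mulmx1 -LLKK mulmxDr mulmxDl mxE.
by rewrite !trmx_mul !mulmxA.
Qed.

Lemma sqr_enorm_residual y :
  enorm (y - orthproj U y) ^+ 2 = enorm (y *m K) ^+ 2.
Proof.
rewrite !sqr_enorm dotv_frame projE !mulmxBl -!(mulmxA _ L^T) LL LK.
by rewrite mulmx1 subrr linear0l add0r mulmx0 subr0.
Qed.

(** Along [L] the signal cancels and only the noise remains; along [K] the projection is 0 and only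
    the bias [f *m K] remains. *)
Lemma sqr_enorm_loss f s e : enorm (f - orthproj U (f + s *: e)) ^+ 2
  = enorm (f *m K) ^+ 2 + s ^+ 2 * enorm (e *m L) ^+ 2.
Proof.
rewrite !sqr_enorm dotv_frame projE !mulmxBl -!(mulmxA _ L^T) LL LK.
rewrite mulmx1 mulmx0 subr0 mulmxDl opprD addrA subrr add0r addrC.
congr (_ + _).
by rewrite -scalemxAl -scaleNr linearZl_LR linearZr_LR/= mulrA -expr2 sqrrN.
Qed.

End projection_norms.

(** * Central tails and the critical value of the test *)

Section chi2_tail.
Context {R : realType}.

Lemma std_gauss_tail d (r u : R) : 1 - u <= chi2_cdf 0 d r ->
  (std_gauss d [set v : 'rV[R]_d | (r < enorm v ^+ 2)%R] <= u%:E)%E.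
Proof.
move=> ur; pose A := [set v : 'rV[R]_d | enorm (0 + v) ^+ 2 <= r].
have mA : measurable A by exact: measurable_enorm_le.
rewrite (_ : mkset _ = ~` A); last first.
  by apply/seteqP; split => v; rewrite /A/= add0r ltNge => /negP.
rewrite probability_setC// /A -chi2_mean0 -chi2_cdfE -EFinB lee_fin; lra.
Qed.

Lemma chi2_cdf_le1 z d (x : R) : chi2_cdf z d x <= 1.
Proof.
by rewrite -lee_fin chi2_cdfE probability_le1//; exact: measurable_enorm_le.
Qed.

(** The central cdf vanishes at nonpositive arguments but is at least [1 - alpha] at the critical
    value. Positivity of the latter makes every noncentral acceptance probability nonzero, as
    [conf_radius_pos] requires. *)
Lemma critP d (alpha : R) : 0 < alpha < 1 -> (0 < d)%N ->
  0 < crit alpha d /\ 1 - alpha <= chi2_cdf 0 d (crit alpha d).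
Proof.
move=> a01 d0; have [q [qE aq]] := chi2_quantileP d a01.
rewrite /crit qE/=; split => //; rewrite ltNge; apply/negP.
move=> /(chi2_cdf_le0 d0) q0; move: aq; rewrite q0; move: a01 => /andP[]; lra.
Qed.

End chi2_tail.

(** * Lower bounds on the squared radii *)

Section radius.
Context {R : realType} {n : nat} {M : finType}.
Variables (sigma alpha : R) (full : M) (S : M -> {vspace 'rV[R]_n}).
Variable b : M -> R.
Hypotheses (sigma0 : 0 < sigma) (alpha01 : 0 < alpha < 1)
  (b01 : forall m, 0 < b m < 1)
  (dimS : forall m, m != full -> (\dim (S m) < n)%N).

Local Notation rho := (conf_radius sigma alpha full S b).
Local Notation F m z :=
  (chi2_cdf z (n - \dim (S m)) (crit alpha (n - \dim (S m)))).

Let ssigma0 : 0 < sigma ^+ 2. Proof. by rewrite exprn_gt0. Qed.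

Lemma sqr_conf_radius_ge m (r x : R) :
  conf_radius_sq sigma alpha full S b m = (r%:E * (sigma ^+ 2)%:E)%E ->
  x <= r -> x * sigma ^+ 2 <= rho m ^+ 2.
Proof.
move=> E xr; rewrite /conf_radius E -EFinM /=.
apply: (@le_trans _ _ (r * sigma ^+ 2)); first by rewrite ler_pM2r.
(* A negative value is replaced by 0 under the square root, which only increases the right-hand
   side. *)
have [r0|r0] := leP 0 (r * sigma ^+ 2); first by rewrite sqr_sqrtr.
by rewrite (le_trans (ltW r0))// sqr_ge0.
Qed.

Lemma conf_radius_full : exists r : R,
  1 - b full <= chi2_cdf 0 n r /\ r * sigma ^+ 2 <= rho full ^+ 2.
Proof.
have [q [qE bq]] := chi2_quantileP n (b01 full).
exists q; split => //; apply: (@sqr_conf_radius_ge _ q) => //.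
by rewrite /conf_radius_sq eqxx qE.
Qed.

(* The supremum defining the radius has to be shown finite, since fine would
   send +oo to 0. It is because the cdf F is positive (b / 0 = 0 would give an
   infinite quantile) and drops below b for large z, where the quantile becomes
   -oo. *)
Lemma conf_radius_pos m (z : R) : m != full -> \dim (S m) != 0%N -> 0 <= z ->
  b m < F m z -> exists r : R,
  1 - b m / F m z <= chi2_cdf 0 (\dim (S m)) r /\
  (z + r) * sigma ^+ 2 <= rho m ^+ 2.
Proof.
move=> mf Dm z0 bF; have /andP[b0 b1] := b01 m.
have N0 : (0 < n - \dim (S m))%N by rewrite subn_gt0 dimS.
have [c0 _] := critP alpha01 N0.
have F0 w : 0 < F m w by exact: chi2_cdf_gt0.
pose Q w := chi2_quantile 0 (\dim (S m)) (Num.min (b m / F m w) 1).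
have [q [qE bq]] := chi2_quantileP (\dim (S m)) (b01 m).
have bF01 : 0 < b m / F m z < 1.
  by rewrite divr_gt0//= ltr_pdivrMr// mul1r.
have [r [rE br]] := chi2_quantileP (\dim (S m)) bF01.
have QzE : Q z = r%:E by rewrite /Q min_l// ltW//; case/andP: bF01.
have [z1 z10 z1F] := chi2_cdf_vanish (crit alpha (n - \dim (S m))) N0 b0.
pose s := ereal_sup [set (w%:E + Q w)%E | w in [set w : R | 0 <= w]].
have s_ub : (s <= (z1 + q)%:E)%E.
  apply: ge_ereal_sup => _ [w /= w0 <-].
  have [z1w|wz1] := leP z1 w.
    rewrite /Q min_r; first by rewrite chi2_quantile1 addeNy leNye.
    by rewrite ler_pdivlMr// mul1r z1F.
  (* A cdf is at most 1, so the ratio is at least [b m] and the quantile is at most [q]. *)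
  rewrite EFinD; apply: leeD; first by rewrite lee_fin ltW.
  rewrite -qE; apply: chi2_quantile_antitone.
  rewrite le_min (ltW b1) andbT ler_pdivlMr// ler_piMr//; first exact: ltW.
  exact: chi2_cdf_le1.
have s_lb : ((z + r)%:E <= s)%E.
  by apply: ereal_sup_ubound; exists z => //=; rewrite QzE.
have sE : s = (fine s)%:E.
  rewrite fineK// fin_numE; apply/andP; split.
    by rewrite -ltNye (lt_le_trans _ s_lb)// ltNyr.
  by rewrite -ltey (le_lt_trans s_ub)// ltry.
exists r; split => //; apply: (@sqr_conf_radius_ge _ (fine s)).
  by rewrite /conf_radius_sq (negbTE mf) Dm -/s -sE.
by rewrite -lee_fin -sE.
Qed.

(** Since the cdf is antitone in the noncentrality, every point of the set defining the infimum is
    at least [z]. [chi2_cdf_vanish] supplies a point of that set, so the infimum is not +oo. *)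
Lemma conf_radius_dim0 m (z : R) : m != full -> \dim (S m) = 0%N -> 0 <= z ->
  b m < F m z -> z * sigma ^+ 2 <= rho m ^+ 2.
Proof.
move=> mf Dm z0; rewrite Dm subn0 => bF; have /andP[b0 b1] := b01 m.
have n0 : (0 < n)%N by rewrite (leq_ltn_trans _ (dimS mf)).
have [z1 z10 z1F] := chi2_cdf_vanish (crit alpha n) n0 b0.
pose A := [set w : R | 0 <= w /\ chi2_cdf w n (crit alpha n) <= b m].
pose s := ereal_inf [set w%:E | w in A].
have s_ub : (s <= z1%:E)%E.
  by apply: ereal_inf_lbound; exists z1 => //; split => //; exact: z1F.
have s_lb : (z%:E <= s)%E.
  apply: le_ereal_inf_tmp => _ [w /= [w0 wb] <-]; rewrite lee_fin leNgt.
  apply/negP => wz; move: bF; rewrite ltNge => /negP; apply.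
  by apply: le_trans wb; apply: chi2_cdf_antitone => //; exact: ltW.
have sE : s = (fine s)%:E.
  rewrite fineK// fin_numE; apply/andP; split.
    by rewrite -ltNye (lt_le_trans _ s_lb)// ltNyr.
  by rewrite -ltey (le_lt_trans s_ub)// ltry.
apply: (@sqr_conf_radius_ge _ (fine s)).
  by rewrite /conf_radius_sq (negbTE mf) Dm eqxx -/s -sE.
by rewrite -lee_fin -sE.
Qed.

End radius.

(** * Acceptance and miss probabilities of a single model *)

Section model_events.
Context {R : realType} {n : nat} {M : finType}.
Variables (sigma alpha : R) (full : M) (S : M -> {vspace 'rV[R]_n}).
Variable b : M -> R.
Hypotheses (sigma0 : 0 < sigma) (alpha01 : 0 < alpha < 1)
  (b01 : forall m, 0 < b m < 1)
  (dimS : forall m, m != full -> (\dim (S m) < n)%N).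

Local Notation rho := (conf_radius sigma alpha full S b).
Local Notation test := (gof_test sigma alpha full S).

Let ssigma0 : 0 < sigma ^+ 2. Proof. by rewrite exprn_gt0. Qed.

Lemma measurable_orthproj (U : {vspace 'rV[R]_n}) :
  measurable_fun setT (orthproj U).
Proof.
have [L [K [_ _ _ projE _]]] := exists_frame U.
have -> : orthproj U = fun y => y *m (L *m L^T).
  by apply/funext => y; rewrite projE mulmxA.
exact: measurable_mulmxr.
Qed.

Lemma measurable_rV_sub d (T : measurableType d) (g h : T -> 'rV[R]_n) :
  measurable_fun setT g -> measurable_fun setT h ->
  measurable_fun setT (fun t => g t - h t).
Proof.
move=> mg mh; apply: measurable_fun_rV => i; under eq_fun do rewrite !mxE.
by apply: measurable_funB; apply: (measurableT_comp (measurable_coord i)).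
Qed.

Lemma measurable_enorm k : measurable_fun setT (@enorm R k).
Proof.
rewrite (_ : enorm = Num.sqrt \o (fun v => enorm (0 + v) ^+ 2)).
  apply: measurableT_comp; last exact: measurable_sqr_enorm.
  by apply: continuous_measurable_fun; exact: sqrt_continuous.
by apply/funext => v /=; rewrite add0r sqrtr_sqr ger0_norm ?sqrtr_ge0.
Qed.

Lemma measurable_le_cst d (T : measurableType d) (g : T -> R) (r : R) :
  measurable_fun setT g -> measurable [set t | g t <= r].
Proof.
move=> mg; rewrite (_ : mkset _ = g @^-1` `]-oo, r]).
  exact: measurable_preimage.
by apply/seteqP; split => t /=; rewrite in_itv.
Qed.

Lemma measurable_gt_cst d (T : measurableType d) (g : T -> R) (r : R) :
  measurable_fun setT g -> measurable [set t | r < g t].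
Proof.
move=> mg; rewrite (_ : mkset _ = g @^-1` `]r, +oo[).
  exact: measurable_preimage.
by apply/seteqP; split => t /=; rewrite in_itv/= andbT.
Qed.

Lemma measurable_sqr_enorm_gt k (r : R) :
  measurable [set v : 'rV[R]_k | r < enorm v ^+ 2].
Proof.
by apply: measurable_gt_cst; apply: measurable_funX; exact: measurable_enorm.
Qed.

Lemma measurable_accept m : measurable [set y | test m y = false].
Proof.
have [->|mf] := eqVneq m full.
  rewrite (_ : mkset _ = setT)//.
  by apply/seteqP; split => y //=; rewrite /gof_test eqxx.
rewrite (_ : mkset _ = [set y | enorm (y - orthproj (S m) y) ^+ 2
    <= crit alpha (n - \dim (S m)) * sigma ^+ 2]).
  apply: measurable_le_cst; apply: measurable_funX.
  apply: (measurableT_comp (@measurable_enorm n)).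
  by apply: measurable_rV_sub => //; exact: measurable_orthproj.
apply/predeqP => y /=; rewrite /gof_test mf/= leNgt.
by split => [->|/negbTE].
Qed.

Lemma measurable_cover m f :
  measurable [set y | eball (estimator full S m y) (rho m) f].
Proof.
apply: measurable_le_cst; apply: (measurableT_comp (@measurable_enorm n)).
apply: measurable_rV_sub => //; rewrite /estimator.
by case: eqP => // _; exact: measurable_orthproj.
Qed.

Let le_radius (x r : R) : 0 <= r -> 0 <= x -> ~ (x <= r) -> r ^+ 2 < x ^+ 2.
Proof.
move=> r0 x0 /negP; rewrite -ltNge => rx.
by rewrite ltrXn2r ?nnegrE.
Qed.

Lemma gauss_law_miss m f : (gauss_law f sigma
    [set y | test m y = false /\ ~ eball (estimator full S m y) (rho m) f]
  <= (b m)%:E)%E.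
Proof.
have mE : measurable
    [set y | test m y = false /\ ~ eball (estimator full S m y) (rho m) f].
  exact: measurableI (measurable_accept m) (measurableC (measurable_cover m f)).
rewrite -[X in (X <= _)%E]/(std_gauss n (observation f sigma @^-1` _)).
have mobs := measurable_preimage (measurable_observation f sigma) mE.
have rho0 : 0 <= rho m by exact: sqrtr_ge0.
have [mf|mf] := eqVneq m full.
  have [r [br rr]] := conf_radius_full alpha full S sigma0 b01.
  subst m; apply: le_trans (std_gauss_tail br).
  apply: le_measure; rewrite ?inE.
  - exact: mobs.
  - exact: measurable_sqr_enorm_gt.
  - move=> e /= [_]; rewrite /eball /estimator eqxx /= => /le_radius.
    move=> /(_ rho0 (sqrtr_ge0 _)) /(le_lt_trans rr).
    rewrite opprD addrA subrr add0r -scaleNr sqr_enormZ sqrrN.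
    by rewrite mulrC ltr_pM2l.
have [L [K [LL LK LLKK projE _]]] := exists_frame (S m).
set p := \dim (S m); set q := (n - p)%N.
pose mu := sigma^-1 *: (f *m K); pose z := dotv mu mu.
have zE : enorm (f *m K) ^+ 2 = sigma ^+ 2 * z.
  by rewrite /z -sqr_enorm -sqr_enormZ scalerA mulfV ?gt_eqF// scale1r.
have z0 : 0 <= z by exact: dotvv_ge0.
(* The miss is expressed through [rho m] itself, so that the factorization serves all the cases
   below; a quantile [r] enters only in the last one. *)
pose A := [set v : 'rV[R]_p | rho m ^+ 2 < sigma ^+ 2 * (z + enorm v ^+ 2)].
pose B := [set v : 'rV[R]_q | enorm (mu + v) ^+ 2 <= crit alpha q].
have mB : measurable B by exact: measurable_enorm_le.
have mA : measurable A.
  apply: measurable_gt_cst; apply: measurable_funM => //.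
  apply: measurable_funD => //; apply: measurable_funX; exact: measurable_enorm.
have pq : (p + q = n)%N by rewrite subnKC// ltnW// dimS.
apply: (@le_trans _ _ (std_gauss n [set v | A (v *m L) /\ B (v *m K)])).
  apply: le_measure; rewrite ?inE.
  - exact: mobs.
  - apply: (@measurableI _ _ ((mulmx^~ L) @^-1` A) ((mulmx^~ K) @^-1` B)).
      by apply: measurable_preimage mA; exact: measurable_mulmxr.
    by apply: measurable_preimage mB; exact: measurable_mulmxr.
  - move=> e /= []; rewrite /gof_test mf/= => /negbT; rewrite -leNgt.
    rewrite (sqr_enorm_residual LL LK LLKK projE) => acc.
    rewrite /eball /estimator (negbTE mf) => /le_radius.
    move=> /(_ rho0 (sqrtr_ge0 _)).
    rewrite (sqr_enorm_loss LL LK LLKK projE) zE -mulrDr => miss; split => //.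
    rewrite /B/= -(ler_pM2r ssigma0); apply: le_trans acc.
    rewrite mulmxDl -scalemxAl.
    have -> : f *m K + sigma *: (e *m K) = sigma *: (mu + e *m K).
      by rewrite scalerDr scalerA mulfV ?gt_eqF// scale1r.
    by rewrite sqr_enormZ mulrC.
rewrite (std_gauss_isometry_split pq LLKK mA mB) std_gauss_enorm_le -/z.
have [Fb|bF] := leP (chi2_cdf z q (crit alpha q)) (b m).
  apply: (@le_trans _ _ (1 * (chi2_cdf z q (crit alpha q))%:E)%E).
    apply: lee_wpmul2r; first by rewrite lee_fin chi2_cdf_ge0.
    exact: probability_le1.
  by rewrite mul1e lee_fin.
have F0 : 0 < chi2_cdf z q (crit alpha q).
  by apply: le_lt_trans bF; rewrite ltW//; case/andP: (b01 m).
(* In dimension 0 the loss has no noise term, so a miss is impossible once the squared radius is at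
   least [z * sigma ^+ 2]. *)
have [p0|p0] := eqVneq p 0%N.
  have zr := conf_radius_dim0 sigma0 b01 dimS mf p0 z0 bF.
  rewrite (_ : A = set0); last first.
    apply/seteqP; split => v //=; rewrite /A/= sqr_enorm.
    have -> : dotv v v = 0.
      by apply: big1 => i; have := ltn_ord i; rewrite [X in (_ < X)%N]p0.
    by rewrite addr0 mulrC ltNge zr.
  by rewrite measure0 mul0e lee_fin ltW//; case/andP: (b01 m).
have [r [br zr]] := conf_radius_pos sigma0 alpha01 b01 dimS mf p0 z0 bF.
apply: (@le_trans _ _ ((b m / chi2_cdf z q (crit alpha q))%:E
    * (chi2_cdf z q (crit alpha q))%:E)%E).
  apply: lee_wpmul2r; first by rewrite lee_fin chi2_cdf_ge0.
  apply: le_trans (std_gauss_tail br).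
  apply: le_measure; rewrite ?inE//.
    exact: measurable_sqr_enorm_gt.
  move=> v; rewrite /A/= => /(le_lt_trans zr).
  by rewrite mulrC ltr_pM2l// ltrD2l.
by rewrite -EFinM divfK ?gt_eqF.
Qed.

(** The component of [f] along [K] vanishes, so acceptance is a central chi-square event, whose
    probability [critP] bounds below. *)
Lemma gauss_law_accept m f : f \in S m ->
  ((1 - alpha)%:E <= gauss_law f sigma [set y | test m y = false])%E.
Proof.
move=> fS; have /andP[a0 a1] := alpha01.
have [->|mf] := eqVneq m full.
  rewrite (_ : mkset _ = setT) ?probability_setT ?lee_fin; first lra.
  by apply/seteqP; split => y //=; rewrite /gof_test eqxx.
have [L [K [LL LK LLKK projE SK]]] := exists_frame (S m).
set p := \dim (S m) in L K LL LK LLKK projE SK *.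
set q := (n - p)%N in K LK LLKK SK *.
have q0 : (0 < q)%N by rewrite subn_gt0 dimS.
have [_ acrit] := critP alpha01 q0.
pose B := [set v : 'rV[R]_q | enorm (0 + v) ^+ 2 <= crit alpha q].
have mB : measurable B by exact: measurable_enorm_le.
have pq : (p + q = n)%N by rewrite subnKC// ltnW// dimS.
have := std_gauss_isometry_split pq LLKK measurableT mB.
rewrite probability_setT mul1e std_gauss_enorm_le linear0l => PB.
apply: (@le_trans _ _ (chi2_cdf 0 q (crit alpha q))%:E).
  by rewrite lee_fin.
rewrite -PB -[X in (_ <= X)%E]/(std_gauss n (observation f sigma @^-1` _)).
apply: le_measure; rewrite ?inE.
- apply: (@measurableI _ _ ((mulmx^~ L) @^-1` setT) ((mulmx^~ K) @^-1` B)).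
    by apply: measurable_preimage measurableT; exact: measurable_mulmxr.
  by apply: measurable_preimage mB; exact: measurable_mulmxr.
- apply: measurable_preimage (measurable_accept m).
  exact: measurable_observation.
- move=> e /= [_]; rewrite /B/= add0r /gof_test mf/= => eB.
  apply/negbTE; rewrite -leNgt (sqr_enorm_residual LL LK LLKK projE).
  rewrite /observation mulmxDl (SK _ fS) add0r -scalemxAl sqr_enormZ.
  by rewrite mulrC ler_pM2r.
Qed.

End model_events.

(** * Union bound over the models and conclusion *)

Lemma le_measure_cover d (T : measurableType d) (R : realType)
    (mu : {measure set T -> \bar R}) (I : finType)
    (B : set T) (A : I -> set T) :
  (forall i, measurable (A i)) -> measurable B ->
  (forall x, B x -> exists i, A i x) -> (mu B <= \sum_i mu (A i))%E.
Proof.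
move=> mA mB BA.
apply: (@le_trans _ _ (mu (\big[setU/set0]_i A i))).
  apply: le_measure; rewrite ?inE//; first exact: bigsetU_measurable.
  move=> x /BA[i Aix]; rewrite -bigcup_seq; exists i => //=.
  exact: mem_index_enum.
elim: (index_enum I) => [|i s IH]; first by rewrite !big_nil measure0.
have mU : measurable (\big[setU/set0]_(j <- s) A j).
  exact: bigsetU_measurable.
rewrite !big_cons.
have AU : (mu (A i `|` \big[setU/set0]_(j <- s) A j)
    <= mu (A i) + mu (\big[setU/set0]_(j <- s) A j))%E by exact: measureU2.
by apply: (le_trans AU); exact: leeD.
Qed.

Theorem theorem2p1 (R : realType) (n : nat) (sigma beta alpha : R)
    (M : finType) (full : M) (S : M -> {vspace 'rV[R]_n}) (b : M -> R)
    (mhat : 'rV[R]_n -> M) :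
  (1 <= n)%N ->
  0 < sigma ->
  0 < beta < 1 ->
  0 < alpha < 1 - beta ->
  S full = fullv ->
  (forall m, m != full -> (\dim (S m) < n)%N) ->
  (forall m, 0 < b m < 1) ->
  \sum_m b m <= beta ->
  is_selection sigma alpha full S b mhat ->
  let rho := conf_radius sigma alpha full S b in
  let fhat y := estimator full S (mhat y) y in
  let rhohat y := rho (mhat y) in
  [/\ (forall f : 'rV[R]_n,
        ((1 - beta)%:E <=
         gauss_law f sigma [set y | eball (fhat y) (rhohat y) f])%E),
      (forall (m : M) (f : 'rV[R]_n) (gamma : R), 0 < gamma < 1 ->
        ((1 - gamma)%:E <=
         gauss_law f sigma [set y | gof_test sigma alpha full S m y = false])%E ->
        ((1 - gamma)%:E <=
         gauss_law f sigma [set y | (rhohat y <= rho m)%R])%E)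
    & (forall m : M,
        ((1 - alpha)%:E <=
         ereal_inf [set gauss_law f sigma [set y | (rhohat y <= rho m)%R]
                   | f in [set f : 'rV[R]_n | f \in S m]])%E)].
Proof.
move=> _ sigma0 _ /andP[a0 a1] _ dimS b01 sumb [macc [mmin mmeas]].
move=> rho fhat rhohat.
have beta0 : 0 <= beta.
  by apply: le_trans sumb; apply: sumr_ge0 => m _; case/andP: (b01 m) => /ltW.
have alpha01 : 0 < alpha < 1 by apply/andP; split; lra.
(* [M] is finite, so measurability of the preimages of single indices extends to every event on the
   selected index. *)
have mselect (Q : set M) : measurable [set y | Q (mhat y)].
  rewrite (_ : mkset _ = \bigcup_(m in Q) mhat @^-1` [set m]).
    exact: fin_bigcup_measurable.
  by apply/predeqP => y /=; split => [Qy|[m Qm /= ->]//]; exists (mhat y).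
have small_radius (m : M) (f : 'rV[R]_n) (gamma : R) : 0 < gamma < 1 ->
    ((1 - gamma)%:E <=
     gauss_law f sigma [set y | gof_test sigma alpha full S m y = false])%E ->
    ((1 - gamma)%:E <= gauss_law f sigma [set y | (rhohat y <= rho m)%R])%E.
  move=> _ h; apply: le_trans h _; apply: le_measure; rewrite ?inE.
  - exact: measurable_accept.
  - exact: (mselect [set k | rho k <= rho m]).
  (* An accepted [m] competes in the minimum, so the selected radius is at most [rho m]. *)
  - by move=> y /= my; apply: mmin; rewrite inE my.
split => [f|//|m]; last first.
  apply: le_ereal_inf_tmp => _ [f /= fS <-].
  by apply: small_radius => //; exact: gauss_law_accept.
set E := [set y | _].
have mE : measurable E.
  (* The center and the radius both vary with the selected index; splitting on its value reduces to
     balls attached to a fixed model. *)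
  rewrite (_ : E = \bigcup_(m in setT) ([set y | mhat y = m]
      `&` [set y | eball (estimator full S m y) (rho m) f])).
    apply: fin_bigcup_measurable => // m _; apply: measurableI.
      exact: (mselect [set m]).
    exact: measurable_cover.
  apply/predeqP => y; split => [Ey|[m _ [/= my]]]; last by rewrite -my.
  by exists (mhat y).
have : (gauss_law f sigma (~` E) <= beta%:E)%E.
  pose A m := [set y | gof_test sigma alpha full S m y = false
    /\ ~ eball (estimator full S m y) (rho m) f].
  have mA m : measurable (A m).
    apply: measurableI; first exact: measurable_accept.
    by apply: measurableC; exact: measurable_cover.
  (* The selected index is always accepted, so when the ball misses [f] the event [A] occurs at that
     index. *)
  have cover : (gauss_law f sigma (~` E) <= \sum_m gauss_law f sigma (A m))%E.
    apply: le_measure_cover mA (measurableC mE) _ => y nEy.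
    by exists (mhat y); split => //; have := macc y; rewrite inE => /negbTE.
  apply: (le_trans cover); apply: (@le_trans _ _ (\sum_m (b m)%:E)%E).
    by apply: lee_sum => m _; exact: gauss_law_miss.
  by rewrite sumEFin lee_fin.
rewrite probability_setC// -(@fineK _ (gauss_law f sigma E)) ?fin_num_measure//.
rewrite -EFinB !lee_fin; lra.
Qed.
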